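(* Let $I_{\rm ufv}\subset\mathbb{Q}[p_{01},p_{02},p_{03},p_{12},p_{13},p_{23},a,b,c,d,e,f,g,h]$ be the ideal of the universal Fano variety in $\mathbb{P}^5\times\mathbb{P}^7$ of lines on octanomial cubic surfaces $$a\,xyz+b\,xyw+c\,xzw+d\,yzw+e\,x^2y+f\,xy^2+g\,z^2w+h\,zw^2=0 .$$ Then $I_{\rm ufv}$ has $15$ minimal primes: $9=4+4+1$ of degree $1$ and $6=2+4$ of degree $3$, where the degree is the size of the (generic) fiber over the $\mathbb{P}^7$ of octanomials. In terms of the $27$ lines on the surface, these are as follows: (i) Four of the lines (degree $1$ each) are the coordinate lines $\langle x,z\rangle$, $\langle x,w\rangle$, $\langle y,z\rangle$, $\langle y,w\rangle$. (ii) Another four (degree $1$ each) are lines in coordinate planes in $\mathbb{P}^3$, namely $\langle x,\,dy+gz+hw\rangle$, $\langle y,\,cx+gz+hw\rangle$, $\langle z,\,ex+fy+bw\rangle$ and $\langle w,\,ex+fy+az\rangle$. (iii) One unique line (degree $1$) is disjoint from the coordinate lines. It has Plücker coordinates $$(p_{01}:p_{02}:p_{03}:p_{12}:p_{13}:p_{23})=(bg-ah:\ fh-bd:\ ad-fg:\ bc-eh:\ eg-ac:\ cf-de).$$ (iv) Two triples of lines (degree $3$ each) intersect pairs of coordinate lines. (v) Four triples of lines (degree $3$ each) intersect precisely one coordinate line each.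
   Context: A line in $\mathbb{P}^3$ with coordinates $(x:y:z:w)$ (indexed $0,1,2,3$) is encoded by its Plücker coordinates $(p_{01}:p_{02}:p_{03}:p_{12}:p_{13}:p_{23})\in\mathbb{P}^5$, so that the affine cone over the line is the image of the skew-symmetric $4\times4$ matrix $P=(p_{ij})$. A point of $\mathbb{P}^7$ is a coefficient vector $(a:b:\cdots:h)$ of an octanomial. The universal Fano variety consists of the pairs (line, octanomial) such that the line lies on the octanomial surface. Its ideal $I_{\rm ufv}$ is generated by the Plücker relation $p_{01}p_{23}-p_{02}p_{13}+p_{03}p_{12}$ together with the $20$ coefficients (polynomials in the $p_{ij}$ and $a,\dots,h$) of the cubic form in $u=(u_0,u_1,u_2,u_3)$ obtained by substituting $(x,y,z,w)^T=Pu$ into the octanomial. The notation $\langle \ell,\ell'\rangle$ denotes the line where the linear forms $\ell,\ell'$ vanish. Coordinate lines are lines where two of the coordinates $x,y,z,w$ vanish. Statements about the lines refer to generic $(a:\cdots:h)$. *)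

(* Defs.v *)
From mathcomp Require Import all_boot all_order all_algebra.
From mathcomp Require Import boolp classical_sets.
From mathcomp Require Import mpoly.

Set Implicit Arguments.
Unset Strict Implicit.
Unset Printing Implicit Defensive.

Import GRing.Theory Num.Theory.

Local Open Scope classical_set_scope.
Local Open Scope ring_scope.

Section Ideals.
Variable R : comNzRingType.

Definition ideal_generated (S : set R) : set R :=
  [set q | exists2 s : seq (R * R),
     {in s, forall ag, S ag.2} & q = \sum_(ag <- s) ag.1 * ag.2].

(* [idealr_closed] includes properness. *)
Definition prime_ideal (P : set R) : Prop :=
  idealr_closed (fun x => x \in P) /\ prime_idealr_closed (fun x => x \in P).

Definition minimal_prime (I P : set R) : Prop :=
  [/\ prime_ideal P, I `<=` P &
      forall Q, prime_ideal Q -> I `<=` Q -> Q `<=` P -> Q = P].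

End Ideals.

(* Pluecker vectors list p01, p02, p03, p12, p13, p23 in this order;
   coefficient vectors list a, b, c, d, e, f, g, h in this order;
   the coordinates x, y, z, w have indices 0, 1, 2, 3. *)
Section Geometry.
Variable R : comNzRingType.

Definition octanomial (t : 'rV[R]_8) (v : 'cV[R]_4) : R :=
  let: (a, b, c, d) := (t 0 0, t 0 1, t 0 2, t 0 3) in
  let: (e, f, g, h) := (t 0 4, t 0 5, t 0 6, t 0 7) in
  let: (x, y, z, w) := (v 0 0, v 1 0, v 2 0, v 3 0) in
  a * x * y * z + b * x * y * w + c * x * z * w + d * y * z * w
  + e * x ^+ 2 * y + f * x * y ^+ 2 + g * z ^+ 2 * w + h * z * w ^+ 2.

Definition plucker_relation (p : 'rV[R]_6) : R :=
  p 0 0 * p 0 5 - p 0 1 * p 0 4 + p 0 2 * p 0 3.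

Definition plucker_mx (p : 'rV[R]_6) : 'M[R]_4 :=
  \matrix_(i, j) nth 0 (nth [::]
    [:: [:: 0; p 0 0; p 0 1; p 0 2];
        [:: - p 0 0; 0; p 0 3; p 0 4];
        [:: - p 0 1; - p 0 3; 0; p 0 5];
        [:: - p 0 2; - p 0 4; - p 0 5; 0]] i) j.

Definition line_of (p : 'rV[R]_6) : set 'cV[R]_4 :=
  [set v | exists u, v = plucker_mx p *m u].

(* The line <l, l'> where the two linear forms l and l' vanish; a linear form
   is the row vector of its coefficients in x, y, z, w. *)
Definition form_line (l l' : 'rV[R]_4) : set 'cV[R]_4 :=
  [set v | l *m v = 0 /\ l' *m v = 0].

Definition coord_form (i : 'I_4) : 'rV[R]_4 := delta_mx 0 i.

(* For #|S| = 2, the coordinate line cut out by the two coordinates in S. *)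
Definition coordinate_line (S : {set 'I_4}) : set 'cV[R]_4 :=
  [set v | forall i, i \in S -> v i 0 = 0].

Definition lines_meet (L L' : set 'cV[R]_4) : Prop :=
  exists v, [/\ v != 0, L v & L' v].

Definition octanomial_coord_line (k : 'I_4) : set 'cV[R]_4 :=
  let: (x, y, z, w) :=
    (coord_form 0, coord_form 1, coord_form 2, coord_form 3) in
  tnth [tuple form_line x z; form_line x w; form_line y z; form_line y w] k.

Definition plane_line (t : 'rV[R]_8) (k : 'I_4) : set 'cV[R]_4 :=
  let: (a, b, c, d) := (t 0 0, t 0 1, t 0 2, t 0 3) in
  let: (e, f, g, h) := (t 0 4, t 0 5, t 0 6, t 0 7) in
  let: (x, y, z, w) :=
    (coord_form 0, coord_form 1, coord_form 2, coord_form 3) in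
  tnth [tuple form_line x (d *: y + g *: z + h *: w);
              form_line y (c *: x + g *: z + h *: w);
              form_line z (e *: x + f *: y + b *: w);
              form_line w (e *: x + f *: y + a *: z)] k.

Definition disjoint_line (t : 'rV[R]_8) : 'rV[R]_6 :=
  let: (a, b, c, d) := (t 0 0, t 0 1, t 0 2, t 0 3) in
  let: (e, f, g, h) := (t 0 4, t 0 5, t 0 6, t 0 7) in
  \row_j tnth [tuple b * g - a * h; f * h - b * d; a * d - f * g;
                     b * c - e * h; e * g - a * c; c * f - d * e] j.

End Geometry.

(* The first six variables are p01, ..., p23, the last eight are a, ..., h. *)
Definition ufv_ring : comNzRingType := {mpoly rat[6 + 8]}.

Definition p_vars : 'rV[ufv_ring]_6 := \row_i 'X_(lshift 8 i).
Definition t_vars : 'rV[ufv_ring]_8 := \row_i 'X_(rshift 6 i).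

(* The cubic form in u0, ..., u3 obtained from (x, y, z, w)^T = P u. *)
Definition ufv_cubic : {mpoly ufv_ring[4]} :=
  octanomial (map_mx (@mpolyC 4 ufv_ring) t_vars)
    (map_mx (@mpolyC 4 ufv_ring) (plucker_mx p_vars) *m \col_i 'X_i).

Definition I_ufv : set ufv_ring :=
  ideal_generated
    ([set plucker_relation p_vars] `|`
     [set ufv_cubic@_m | m in [set m : 'X_{1..4} | mdeg m = 3%N]]).

Section Fibers.
Variable C : numClosedFieldType.

(* Points over t of the subvariety of P^5 x P^7 defined by I; [(p == q)%MS],
   equality of row spaces, is equality of points of P^5. *)
Definition fiber (I : set ufv_ring) (t : 'rV[C]_8) : set 'rV[C]_6 :=
  [set p | p != 0 /\
     forall q, I q -> (map_mpoly ratr q).@[fun i => row_mx p t 0 i] = 0].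

Definition fiber_has_size (I : set ufv_ring) (t : 'rV[C]_8) (n : nat) : Prop :=
  exists s : seq 'rV[C]_6,
    [/\ size s = n,
        pairwise (fun p q => ~~ (p == q)%MS) s,
        {in s, forall p, fiber I t p} &
        forall p, fiber I t p -> has (fun q => (p == q)%MS) s].

(* "For generic (a : ... : h)". *)
Definition generically (Phi : 'rV[C]_8 -> Prop) : Prop :=
  exists2 D : {mpoly C[8]},
    D != 0 & forall t : 'rV[C]_8, D.@[fun i => t 0 i] != 0 -> Phi t.

Definition generic_degree (I : set ufv_ring) (n : nat) : Prop :=
  generically (fun t => fiber_has_size I t n).

End Fibers.

(* Labels of the 15 = 4 + 4 + 1 + 2 + 4 minimal primes. *)
Inductive component : Type :=
  | CoordLine of 'I_4
  | PlaneLine of 'I_4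
  | DisjointLine
  | TwoMeeting of 'I_2
  | OneMeeting of 'I_4.

Definition component_degree (k : component) : nat :=
  match k with
  | CoordLine _ | PlaneLine _ | DisjointLine => 1
  | TwoMeeting _ | OneMeeting _ => 3
  end.

(* Main.v *)
Require Import Defs.
From HB Require Import structures.
From mathcomp Require Import all_boot all_order all_algebra.
From mathcomp Require Import ring.
From mathcomp Require Import boolp classical_sets.
From mathcomp Require Import mpoly.

(** The octanomial is x y l1 + z w l2, where l1 = e x + f y + a z + b w and
    l2 = c x + d y + g z + h w are arbitrary linear forms.  A line lies on the
    surface when the binary cubics x y l1 and - z w l2 agree on it, and the
    common factors of x y and z w on the line decide what this means.

    - If x y and z w are coprime on the line, then l1 and l2 vanish on it: it
      is the line l1 = l2 = 0, disjoint from the coordinate lines.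
    - If x = 0 on the line, then z w l2 = 0 on it, so that z, w or l2 vanishes:
      a coordinate line or the line x = l2 = 0.
    - If z is a nonzero multiple of x and y, w are independent on the line,
      then l1 is a multiple of w and l2 of y: such a line meets x = z = 0, and
      in general no other coordinate line.
    - If z and w are nonzero multiples of x and y on the line, then l1 and l2
      are proportional: the line meets x = z = 0 and y = w = 0.

    Up to the symmetries of the octanomial (exchanging x and y, or z and w, or
    the two pairs) these are five families, each the image of a polynomial map
    from affine 9-space.  The fifteen images of these maps under symmetries
    are the components, and the prime belonging to a component is the kernel
    of the corresponding map of polynomial rings ([component_ideal]).

    The case analysis works over every field of characteristic other than 2
    and, thanks to the choice of the parametrisations, puts each point of the
    variety on the nose into the image of one of them, without any passage to
    a closure ([on_some_component]).  Applied to the generic point of a prime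
    containing the ideal, it shows that this prime contains one of the fifteen
    kernels ([prime_over_I_ufv]); applied to complex points, it shows that the
    fibre of the variety is the union of the fibres of the components.  The
    kernels are primes by construction, so that they are the minimal ones once
    they are pairwise incomparable.

    The fibre of a family over a generic octanomial is computed from explicit
    equations in the kernel: it is a single line for coordinate lines, lines
    in coordinate planes and the disjoint line, and for the other two families
    it consists of the lines given by the roots of a cubic polynomial with
    nonzero discriminant ([family_fiber]).  For a line with Plücker
    vector p, meeting the coordinate line x_i = x_j = 0 amounts to p_ij = 0
    ([lines_meet_coordinate]), and the set of vanishing Plücker coordinates
    of the lines over a generic octanomial takes fifteen different values on
    the fifteen components.  This separates
    the components, so that the kernels are incomparable and the degrees add
    up to 27, and it gives all the incidence statements. *)

Set Implicit Arguments.
Unset Strict Implicit.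
Unset Printing Implicit Defensive.

Import GRing.Theory Num.Theory.

Local Open Scope classical_set_scope.
Local Open Scope ring_scope.

(** * The residue field of a prime ideal *)

Section ResidueField.
Variables (R : comNzRingType) (P : prime_idealr R).

Local Notation Q := {ideal_quot P}.

Let quot_unit : {pred Q} := fun x => `[< exists y, y * x = 1 >].
Let quot_inv (x : Q) : Q :=
  if pselect (exists y, y * x = 1) is left e then sval (cid e) else x.

Let quot_mulVx : {in quot_unit, left_inverse 1 quot_inv *%R}.
Proof.
move=> x /asboolP ux; rewrite /quot_inv; case: pselect => // e.
exact: (svalP (cid e)).
Qed.

Let quot_unitPl x y : y * x = 1 -> quot_unit x.
Proof. by move=> yx1; apply/asboolP; exists y. Qed.

Let quot_inv_out : {in [predC quot_unit], quot_inv =1 id}.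
Proof. by move=> x /asboolP nux; rewrite /quot_inv; case: pselect. Qed.

Local HB.instance Definition _ := GRing.ComNzRing_hasMulInverse.Build Q
  quot_mulVx quot_unitPl quot_inv_out.

Local HB.instance Definition _ :=
  GRing.ComUnitRing_isIntegral.Build Q (@Quotient.rquot_IdomainAxiom R P).

(** The generic point of the subscheme cut out by a prime: a morphism to a
    field whose kernel is that prime. *)
Lemma residue_field :
  exists (K : fieldType) (f : {rmorphism R -> K}),
    forall q, f q = 0 <-> q \in P.
Proof.
pose pi : {rmorphism R -> Q} := (\pi_Q)%qT.
exists {fraction Q}, (@tofrac Q \o pi)%FUN => q.
by split=> [/eqP|qP] /=; [rewrite tofrac_eq0|apply/eqP; rewrite tofrac_eq0];
  rewrite -(rmorph0 pi) -Quotient.idealrBE subr0.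
Qed.

End ResidueField.

(** * Coordinates *)

Section Coordinates.
Variable R : comNzRingType.

Definition plucker_vec (p01 p02 p03 p12 p13 p23 : R) : 'rV[R]_6 :=
  \row_j [:: p01; p02; p03; p12; p13; p23]`_j.

Definition coef_vec (a b c d e f g h : R) : 'rV[R]_8 :=
  \row_j [:: a; b; c; d; e; f; g; h]`_j.

Definition point_vec (x y z w : R) : 'cV[R]_4 := \col_i [:: x; y; z; w]`_i.

Lemma plucker_vecE (p : 'rV[R]_6) :
  p = plucker_vec (p 0 0) (p 0 1) (p 0 2) (p 0 3) (p 0 4) (p 0 5).
Proof.
apply/rowP => -[[|[|[|[|[|[|//]]]]]] lt_j6]; rewrite mxE /=; congr (p _ _);
  exact/val_inj.
Qed.

Lemma coef_vecE (t : 'rV[R]_8) :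
  t = coef_vec (t 0 0) (t 0 1) (t 0 2) (t 0 3)
               (t 0 4) (t 0 5) (t 0 6) (t 0 7).
Proof.
apply/rowP => -[[|[|[|[|[|[|[|[|//]]]]]]]] lt_j8]; rewrite mxE /=;
  congr (t _ _); exact/val_inj.
Qed.

Lemma point_vecE (v : 'cV[R]_4) :
  v = point_vec (v 0 0) (v 1 0) (v 2 0) (v 3 0).
Proof.
apply/colP => -[[|[|[|[|//]]]] lt_i4]; rewrite mxE /=; congr (v _ _);
  exact/val_inj.
Qed.

Lemma plucker_vec_coord p01 p02 p03 p12 p13 p23 :
  let p := plucker_vec p01 p02 p03 p12 p13 p23 in
  ((p 0 0 = p01) * (p 0 1 = p02) * (p 0 2 = p03) *
   (p 0 3 = p12) * (p 0 4 = p13) * (p 0 5 = p23))%type.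
Proof. by rewrite /= !mxE. Qed.

Lemma coef_vec_coord a b c d e f g h :
  let t := coef_vec a b c d e f g h in
  ((t 0 0 = a) * (t 0 1 = b) * (t 0 2 = c) * (t 0 3 = d) *
   (t 0 4 = e) * (t 0 5 = f) * (t 0 6 = g) * (t 0 7 = h))%type.
Proof. by rewrite /= !mxE. Qed.

Lemma point_vec_coord x y z w :
  let v := point_vec x y z w in
  ((v 0 0 = x) * (v 1 0 = y) * (v 2 0 = z) * (v 3 0 = w))%type.
Proof. by rewrite /= !mxE. Qed.

Lemma octanomialE a b c d e f g h x y z w :
  octanomial (coef_vec a b c d e f g h) (point_vec x y z w) =
  x * y * (e * x + f * y + a * z + b * w) +
  z * w * (c * x + d * y + g * z + h * w).
Proof. by rewrite /octanomial !coef_vec_coord !point_vec_coord; ring. Qed.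

Lemma plucker_mxE p01 p02 p03 p12 p13 p23 u0 u1 u2 u3 :
  plucker_mx (plucker_vec p01 p02 p03 p12 p13 p23) *m point_vec u0 u1 u2 u3 =
  point_vec (p01 * u1 + p02 * u2 + p03 * u3)
            (- p01 * u0 + p12 * u2 + p13 * u3)
            (- p02 * u0 - p12 * u1 + p23 * u3)
            (- p03 * u0 - p13 * u1 - p23 * u2).
Proof.
apply/colP => -[[|[|[|[|//]]]] lt_i4];
  rewrite mxE !big_ord_recl big_ord0 !mxE /=; ring.
Qed.

Lemma plucker_relationE p01 p02 p03 p12 p13 p23 :
  plucker_relation (plucker_vec p01 p02 p03 p12 p13 p23) =
  p01 * p23 - p02 * p13 + p03 * p12.
Proof. by rewrite /plucker_relation !plucker_vec_coord. Qed.

Lemma disjoint_lineE a b c d e f g h :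
  disjoint_line (coef_vec a b c d e f g h) =
  plucker_vec (b * g - a * h) (f * h - b * d) (a * d - f * g)
              (b * c - e * h) (e * g - a * c) (c * f - d * e).
Proof.
rewrite /disjoint_line !coef_vec_coord; apply/rowP => j.
by rewrite !mxE (tnth_nth 0).
Qed.

(** The conditions hold for the zero vector too, so that this describes the
    affine cone over the universal Fano variety. *)
Definition lies_on (p : 'rV[R]_6) (t : 'rV[R]_8) : Prop :=
  plucker_relation p = 0 /\ forall u, octanomial t (plucker_mx p *m u) = 0.

End Coordinates.

Section CoordinatesMap.
Variables (R S : comNzRingType) (f : {rmorphism R -> S}).

Lemma map_plucker_vec p01 p02 p03 p12 p13 p23 :
  map_mx f (plucker_vec p01 p02 p03 p12 p13 p23) =
  plucker_vec (f p01) (f p02) (f p03) (f p12) (f p13) (f p23).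
Proof. by rewrite [LHS]plucker_vecE !mxE. Qed.

Lemma map_coef_vec a b c d e f0 g h :
  map_mx f (coef_vec a b c d e f0 g h) =
  coef_vec (f a) (f b) (f c) (f d) (f e) (f f0) (f g) (f h).
Proof. by rewrite [LHS]coef_vecE !mxE. Qed.

Lemma map_octanomial t v :
  f (octanomial t v) = octanomial (map_mx f t) (map_mx f v).
Proof.
by rewrite /octanomial !mxE !(rmorphD, rmorphM, rmorphXn).
Qed.

Lemma map_plucker_mx p : map_mx f (plucker_mx p) = plucker_mx (map_mx f p).
Proof.
apply/matrixP => -[[|[|[|[|//]]]] lti] [[|[|[|[|//]]]] ltj]; rewrite !mxE /=;
  by rewrite ?rmorphN ?rmorph0.
Qed.

Lemma map_plucker_relation p :
  f (plucker_relation p) = plucker_relation (map_mx f p).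
Proof. by rewrite /plucker_relation !mxE !(rmorphD, rmorphM, rmorphN). Qed.

End CoordinatesMap.

(** * Evaluating the ideal of the universal Fano variety *)

Section Evaluation.
Variable R : comNzRingType.
Implicit Type f : {rmorphism rat -> R}.

Definition eval_at f (p : 'rV[R]_6) (t : 'rV[R]_8) : ufv_ring -> R :=
  mmap f (fun i => row_mx p t 0 i).

HB.instance Definition _ f p t := GRing.RMorphism.on (eval_at f p t).

Lemma eval_at_p f p t : map_mx (eval_at f p t) p_vars = p.
Proof. by apply/rowP => i; rewrite !mxE /eval_at mmapX mmap1U row_mxEl. Qed.

Lemma eval_at_t f p t : map_mx (eval_at f p t) t_vars = t.
Proof. by apply/rowP => i; rewrite !mxE /eval_at mmapX mmap1U row_mxEr. Qed.

End Evaluation.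

(** Rational constants have a unique image in any ring, so that a morphism is
    determined by the point at which it evaluates. *)
Lemma ufv_morphism_ext (R : comUnitRingType) (g h : {rmorphism ufv_ring -> R}) :
  map_mx g p_vars = map_mx h p_vars -> map_mx g t_vars = map_mx h t_vars ->
  g =1 h.
Proof.
move=> /rowP eq_p /rowP eq_t q.
have gC : (g \o @mpolyC _ rat)%FUN =1 (h \o @mpolyC _ rat)%FUN.
  by move=> c; rewrite !fmorph_eq_rat.
have gX i : g 'X_i = h 'X_i.
  by have := splitK i; case: split => j <-;
    [have := eq_p j | have := eq_t j]; rewrite !mxE.
rewrite (mpolyE q) !rmorph_sum; apply: eq_bigr => m _.
rewrite -mul_mpolyC !rmorphM; congr (_ * _); first exact: gC.
by rewrite mpolyXE_id !rmorph_prod; apply: eq_bigr => i _; rewrite !rmorphXn gX.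
Qed.

Lemma ufv_cubicE :
  ufv_cubic = octanomial (map_mx (@mpolyC 4 ufv_ring) t_vars)
    (plucker_mx (map_mx (@mpolyC 4 ufv_ring) p_vars) *m \col_i 'X_i).
Proof. by rewrite /ufv_cubic map_plucker_mx. Qed.

(** Hence the coefficients in degree 3 are all the coefficients. *)
Lemma ufv_cubic_homog : ufv_cubic \is 3.-homog.
Proof.
rewrite /ufv_cubic.
have homC (c : ufv_ring) : c%:MP_[4] \is 0.-homog.
  by rewrite -[_%:MP]mulr1 mul_mpolyC dhomogZ // dhomog1.
set v := _ *m _.
have v1 i : v i 0 \is 1.-homog.
  rewrite mxE; apply: rpred_sum => j _; rewrite !mxE.
  by apply: (@dhomogM _ _ _ 0 _ 1); [exact: homC | rewrite dhomogX /= mdeg1].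
have t0 j : map_mx (@mpolyC 4 ufv_ring) t_vars 0 j \is 0.-homog.
  by rewrite mxE; exact: homC.
rewrite /octanomial; move: (v1 0) (v1 1) (v1 2) (v1 3).
have m3 c x y z : c \is 0.-homog -> x \is 1.-homog -> y \is 1.-homog ->
    z \is 1.-homog -> (c * x * y * z : {mpoly ufv_ring[4]}) \is 3.-homog.
  by move=> hc hx hy hz; exact: (dhomogM (dhomogM (dhomogM hc hx) hy) hz).
by move=> x1 y1 z1 w1; do !apply: rpredD; rewrite ?expr2 ?mulrA; apply: m3.
Qed.

(** The kernel of a morphism contains the ideal exactly when the point of the
    morphism satisfies the equations with indeterminate u; over a finite ring
    this is stronger than [lies_on], where u ranges over the ring. *)
Lemma I_ufv_sub_kernel (R : comNzRingType) (g : {rmorphism ufv_ring -> R}) :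
  (forall q, I_ufv q -> g q = 0) <->
  plucker_relation (map_mx g p_vars) = 0 /\
  octanomial (map_mx (@mpolyC 4 R) (map_mx g t_vars))
    (plucker_mx (map_mx (@mpolyC 4 R) (map_mx g p_vars)) *m \col_i 'X_i) = 0.
Proof.
have mapC m n (A : 'M[ufv_ring]_(m, n)) :
    map_mx (map_mpoly g) (map_mx (@mpolyC 4 ufv_ring) A) =
    map_mx (@mpolyC 4 R) (map_mx g A).
  by apply/matrixP => i j; rewrite [LHS]mxE mxE [LHS]map_mpolyC !mxE.
have mapX : map_mx (map_mpoly g) (\col_(i < 4) 'X_i) = \col_i 'X_i.
  by apply/matrixP => i j; rewrite [LHS]mxE mxE [LHS]map_mpolyX mxE.
have gcub : map_mpoly g ufv_cubic =
    octanomial (map_mx (@mpolyC 4 R) (map_mx g t_vars))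
    (plucker_mx (map_mx (@mpolyC 4 R) (map_mx g p_vars)) *m \col_i 'X_i).
  by rewrite ufv_cubicE map_octanomial map_mxM map_plucker_mx !mapC mapX.
rewrite -map_plucker_relation -gcub; split=> [gI | [g_plu g_cub] q].
  have gen q : (q = plucker_relation p_vars \/
      exists2 m, mdeg m = 3%N & ufv_cubic@_m = q) -> g q = 0.
    move=> Sq; apply: gI; exists [:: (1, q)]; last by rewrite big_seq1 mul1r.
    by move=> ag; rewrite inE => /eqP ->; case: Sq => [|[m m3 <-]];
      [left | right; exists m].
  split; first by apply: gen; left.
  apply/mpolyP => m; rewrite mcoeff_map_mpoly mcoeff0.
  have [m3 | m_neq3] := eqVneq (mdeg m) 3%N.
    by apply: gen; right; exists m.
  by rewrite (dhomog_nemf_coeff ufv_cubic_homog m_neq3); exact: (rmorph0 g).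
case=> s Ss ->; rewrite rmorph_sum big_seq big1 // => ag /Ss Sag.
rewrite rmorphM; case: Sag => [-> | [m _ <-]]; first by rewrite g_plu mulr0.
by rewrite -mcoeff_map_mpoly g_cub mcoeff0 mulr0.
Qed.

Lemma I_ufv_lies_on (R : comNzRingType) (g : {rmorphism ufv_ring -> R}) :
  (forall q, I_ufv q -> g q = 0) ->
  lies_on (map_mx g p_vars) (map_mx g t_vars).
Proof.
case/I_ufv_sub_kernel => plu cub; split=> // u.
pose ev : {rmorphism {mpoly R[4]} -> R} := meval (fun i => u i 0).
have evC m n (A : 'M[R]_(m, n)) : map_mx ev (map_mx (@mpolyC 4 R) A) = A.
  by apply/matrixP => i j; rewrite !mxE [LHS]mevalC.
have := congr1 ev cub.
rewrite map_octanomial map_mxM map_plucker_mx !evC rmorph0.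
suff -> : map_mx ev (\col_i 'X_i) = u by [].
by apply/colP => i; rewrite !mxE [LHS]mevalXU.
Qed.

(** * Symmetries and the parametrised families *)

Section Symmetries.
Variable R : comNzRingType.
Implicit Types (p : 'rV[R]_6) (t : 'rV[R]_8).

(** The three generators of the group of order 8 that preserves the shape
    x y l1 + z w l2; each acts on Plücker vectors (up to the signs caused by
    reversing a pair of indices) and on coefficient vectors. *)
Definition swap_xy_p p :=
  plucker_vec (- p 0 0) (p 0 3) (p 0 4) (p 0 1) (p 0 2) (p 0 5).
Definition swap_xy_t t :=
  coef_vec (t 0 0) (t 0 1) (t 0 3) (t 0 2) (t 0 5) (t 0 4) (t 0 6) (t 0 7).

Definition swap_zw_p p :=
  plucker_vec (p 0 0) (p 0 2) (p 0 1) (p 0 4) (p 0 3) (- p 0 5).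
Definition swap_zw_t t :=
  coef_vec (t 0 1) (t 0 0) (t 0 2) (t 0 3) (t 0 4) (t 0 5) (t 0 7) (t 0 6).

Definition swap_pairs_p p :=
  plucker_vec (p 0 5) (- p 0 1) (- p 0 3) (- p 0 2) (- p 0 4) (p 0 0).
Definition swap_pairs_t t :=
  coef_vec (t 0 2) (t 0 3) (t 0 0) (t 0 1) (t 0 6) (t 0 7) (t 0 4) (t 0 5).

Definition act_p (s : bool * bool * bool) p :=
  let: (i, j, k) := s in
  let p := if k then swap_pairs_p p else p in
  let p := if j then swap_zw_p p else p in
  if i then swap_xy_p p else p.

Definition act_t (s : bool * bool * bool) t :=
  let: (i, j, k) := s in
  let t := if k then swap_pairs_t t else t in
  let t := if j then swap_zw_t t else t in
  if i then swap_xy_t t else t.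

(** The generators are involutions, but do not all commute: the inverse of
    [act_p] applies them in the opposite order. *)
Definition unact_p (s : bool * bool * bool) p :=
  let: (i, j, k) := s in
  let p := if i then swap_xy_p p else p in
  let p := if j then swap_zw_p p else p in
  if k then swap_pairs_p p else p.

Definition unact_t (s : bool * bool * bool) t :=
  let: (i, j, k) := s in
  let t := if i then swap_xy_t t else t in
  let t := if j then swap_zw_t t else t in
  if k then swap_pairs_t t else t.

Lemma swap_xy_pK : involutive swap_xy_p.
Proof.
by move=> p; rewrite [RHS]plucker_vecE /swap_xy_p !plucker_vec_coord opprK.
Qed.

Lemma swap_xy_tK : involutive swap_xy_t.
Proof. by move=> t; rewrite [RHS]coef_vecE /swap_xy_t !coef_vec_coord. Qed.

Lemma swap_zw_pK : involutive swap_zw_p.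
Proof.
by move=> p; rewrite [RHS]plucker_vecE /swap_zw_p !plucker_vec_coord opprK.
Qed.

Lemma swap_zw_tK : involutive swap_zw_t.
Proof. by move=> t; rewrite [RHS]coef_vecE /swap_zw_t !coef_vec_coord. Qed.

Lemma swap_pairs_pK : involutive swap_pairs_p.
Proof.
by move=> p; rewrite [RHS]plucker_vecE /swap_pairs_p !plucker_vec_coord !opprK.
Qed.

Lemma swap_pairs_tK : involutive swap_pairs_t.
Proof. by move=> t; rewrite [RHS]coef_vecE /swap_pairs_t !coef_vec_coord. Qed.

Lemma act_pK s : cancel (act_p s) (unact_p s).
Proof.
by case: s => [[[] []] []] p //=;
  rewrite ?swap_xy_pK ?swap_zw_pK ?swap_pairs_pK.
Qed.

Lemma unact_pK s : cancel (unact_p s) (act_p s).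
Proof.
by case: s => [[[] []] []] p //=;
  rewrite ?swap_pairs_pK ?swap_zw_pK ?swap_xy_pK.
Qed.

Lemma act_tK s : cancel (act_t s) (unact_t s).
Proof.
by case: s => [[[] []] []] t //=;
  rewrite ?swap_xy_tK ?swap_zw_tK ?swap_pairs_tK.
Qed.

Lemma unact_tK s : cancel (unact_t s) (act_t s).
Proof.
by case: s => [[[] []] []] t //=;
  rewrite ?swap_pairs_tK ?swap_zw_tK ?swap_xy_tK.
Qed.

Lemma swap_xy_lies_on p t :
  lies_on p t -> lies_on (swap_xy_p p) (swap_xy_t t).
Proof.
rewrite (plucker_vecE p) (coef_vecE t) => -[plu cub].
rewrite /swap_xy_p /swap_xy_t !plucker_vec_coord !coef_vec_coord.
split=> [|u].
  move: plu; rewrite !plucker_relationE => plu.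
  by rewrite -[RHS]oppr0 -[in RHS]plu; ring.
have := cub (point_vec (u 1 0) (u 0 0) (u 2 0) (u 3 0)).
rewrite (point_vecE u) !plucker_mxE !octanomialE !point_vec_coord => cub_u.
by rewrite -[RHS]cub_u; ring.
Qed.

Lemma swap_zw_lies_on p t :
  lies_on p t -> lies_on (swap_zw_p p) (swap_zw_t t).
Proof.
rewrite (plucker_vecE p) (coef_vecE t) => -[plu cub].
rewrite /swap_zw_p /swap_zw_t !plucker_vec_coord !coef_vec_coord.
split=> [|u].
  move: plu; rewrite !plucker_relationE => plu.
  by rewrite -[RHS]oppr0 -[in RHS]plu; ring.
have := cub (point_vec (u 0 0) (u 1 0) (u 3 0) (u 2 0)).
rewrite (point_vecE u) !plucker_mxE !octanomialE !point_vec_coord => cub_u.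
by rewrite -[RHS]cub_u; ring.
Qed.

Lemma swap_pairs_lies_on p t :
  lies_on p t -> lies_on (swap_pairs_p p) (swap_pairs_t t).
Proof.
rewrite (plucker_vecE p) (coef_vecE t) => -[plu cub].
rewrite /swap_pairs_p /swap_pairs_t !plucker_vec_coord !coef_vec_coord.
split=> [|u].
  by move: plu; rewrite !plucker_relationE => plu; rewrite -[RHS]plu; ring.
have := cub (point_vec (u 2 0) (u 3 0) (u 0 0) (u 1 0)).
rewrite (point_vecE u) !plucker_mxE !octanomialE !point_vec_coord => cub_u.
by rewrite -[RHS]cub_u; ring.
Qed.

Lemma act_lies_on s p t : lies_on p t -> lies_on (act_p s p) (act_t s t).
Proof.
by case: s => [[[] []] []] /= on_pt; do ?[exact: on_pt
  | apply: swap_xy_lies_on | apply: swap_zw_lies_on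
  | apply: swap_pairs_lies_on].
Qed.

Lemma unact_lies_on s p t : lies_on p t -> lies_on (unact_p s p) (unact_t s t).
Proof.
by case: s => [[[] []] []] /= on_pt; do ?[exact: on_pt
  | apply: swap_xy_lies_on | apply: swap_zw_lies_on
  | apply: swap_pairs_lies_on].
Qed.

Lemma unact_pZ s c p : unact_p s (c *: p) = c *: unact_p s p.
Proof.
have xyZ q : swap_xy_p (c *: q) = c *: swap_xy_p q.
  rewrite [RHS]plucker_vecE /swap_xy_p !mxE.
  by rewrite /= mulrN.
have zwZ q : swap_zw_p (c *: q) = c *: swap_zw_p q.
  rewrite [RHS]plucker_vecE /swap_zw_p !mxE.
  by rewrite /= mulrN.
have prZ q : swap_pairs_p (c *: q) = c *: swap_pairs_p q.
  rewrite [RHS]plucker_vecE /swap_pairs_p !mxE.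
  by rewrite /= !mulrN.
by case: s => [[[] []] []] /=; rewrite ?xyZ ?zwZ ?prZ.
Qed.

Lemma act_pZ s c p : act_p s (c *: p) = c *: act_p s p.
Proof.
by apply: (can_inj (unact_pK s)); rewrite unact_pZ !act_pK.
Qed.

Lemma act_p_neq0 s p : p != 0 -> act_p s p != 0.
Proof.
apply: contra_neq => acp0; rewrite -[p](act_pK s) acp0.
by rewrite -{1}(scale0r (0 : 'rV_6)) unact_pZ scale0r.
Qed.

Lemma unact_p_neq0 s p : p != 0 -> unact_p s p != 0.
Proof.
apply: contra_neq => uap0; rewrite -[p](unact_pK s) uap0.
by rewrite -{1}(scale0r (0 : 'rV_6)) act_pZ scale0r.
Qed.

End Symmetries.

Section SymmetriesMap.
Variables (R S : comNzRingType) (f : {rmorphism R -> S}).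

Lemma map_act_p s p : map_mx f (act_p s p) = act_p s (map_mx f p).
Proof.
have xyM q : map_mx f (swap_xy_p q) = swap_xy_p (map_mx f q).
  by rewrite map_plucker_vec rmorphN /swap_xy_p !mxE.
have zwM q : map_mx f (swap_zw_p q) = swap_zw_p (map_mx f q).
  by rewrite map_plucker_vec rmorphN /swap_zw_p !mxE.
have prM q : map_mx f (swap_pairs_p q) = swap_pairs_p (map_mx f q).
  by rewrite map_plucker_vec !rmorphN /swap_pairs_p !mxE.
by case: s => [[[] []] []] /=; rewrite ?xyM ?zwM ?prM.
Qed.

Lemma map_unact_p s p : map_mx f (unact_p s p) = unact_p s (map_mx f p).
Proof. by rewrite -[in RHS](unact_pK s p) map_act_p act_pK. Qed.

Lemma map_act_t s t : map_mx f (act_t s t) = act_t s (map_mx f t).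
Proof.
have xyM q : map_mx f (swap_xy_t q) = swap_xy_t (map_mx f q).
  by rewrite map_coef_vec /swap_xy_t !mxE.
have zwM q : map_mx f (swap_zw_t q) = swap_zw_t (map_mx f q).
  by rewrite map_coef_vec /swap_zw_t !mxE.
have prM q : map_mx f (swap_pairs_t q) = swap_pairs_t (map_mx f q).
  by rewrite map_coef_vec /swap_pairs_t !mxE.
by case: s => [[[] []] []] /=; rewrite ?xyM ?zwM ?prM.
Qed.

Lemma map_unact_t s t : map_mx f (unact_t s t) = unact_t s (map_mx f t).
Proof. by rewrite -[in RHS](unact_tK s t) map_act_t act_tK. Qed.

End SymmetriesMap.

Inductive line_type := CoordType | PlaneType | DisjointType | TwoType | OneType.

Definition component_type k :=
  match k with
  | CoordLine _ => CoordType
  | PlaneLine _ => PlaneType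
  | DisjointLine => DisjointType
  | TwoMeeting _ => TwoType
  | OneMeeting _ => OneType
  end.

(** The symmetry that carries the model of a family to the given component:
    the models concern x = z = 0 for coordinate lines and lines meeting one of
    them, x = 0 for lines in planes, and both x = z = 0 and y = w = 0 for lines
    meeting two coordinate lines. *)
Definition component_sym k : bool * bool * bool :=
  match k with
  | CoordLine k | OneMeeting k => (2 <= k, odd k, false)%N
  | PlaneLine k => (k == 1 :> nat, k == 3 :> nat, 2 <= k)%N
  | DisjointLine => (false, false, false)
  | TwoMeeting k => (false, k == 1 :> nat, false)
  end.

Section Families.
Variable R : comNzRingType.
Implicit Types (p : 'rV[R]_6) (t : 'rV[R]_8) (s : 'rV[R]_9).

(** The parametrisations solve the conditions on l1 and l2 for a line given by
    two linear equations.
    - Plane: on the line x = 0 with Plücker vector (0, 0, 0, s0, s1, s2), the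
      form l2 vanishes when (h, - g, d) is a multiple s3 of (s0, s1, s2).
    - Disjoint: on y = s1 x + s2 z, w = s3 x + s4 z, the forms l1 and l2 vanish;
      s0 scales the Plücker vector.
    - Two: on z = s1 x, w = s2 y, the condition is l1 + s1 s2 l2 = 0.
    - One: on a line in the plane z = s0 x, the conditions are l1 = s1 s0 w and
      l2 = - s1 y; s7 and s8 are the multiplicities in l1 and l2 of the second
      equation of the line, p13 x - p03 y + p01 w = 0. *)
Definition family_p ty s : 'rV[R]_6 :=
  let: (s0, s1, s2, s3, s4) := (s 0 0, s 0 1, s 0 2, s 0 3, s 0 4) in
  match ty with
  | CoordType => plucker_vec 0 0 0 0 s0 0
  | PlaneType => plucker_vec 0 0 0 s0 s1 s2
  | DisjointType =>
    plucker_vec (s0 * s2) s0 (s0 * s4) (s0 * s1)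
                (s0 * (s1 * s4 - s2 * s3)) (- s0 * s3)
  | TwoType =>
    plucker_vec s0 0 (s0 * s2) (- s0 * s1) 0 (s0 * s1 * s2)
  | OneType =>
    plucker_vec s2 0 s3 (- s0 * s2) s4 (s0 * s3)
  end.

Definition family_t ty s : 'rV[R]_8 :=
  let: (s0, s1, s2, s3, s4) := (s 0 0, s 0 1, s 0 2, s 0 3, s 0 4) in
  let: (s5, s6, s7, s8) := (s 0 5, s 0 6, s 0 7, s 0 8) in
  match ty with
  | CoordType => coef_vec s1 s2 s3 s4 s5 s6 s7 s8
  | PlaneType =>
    coef_vec s4 s5 s6 (s3 * s2) s7 s8 (- s3 * s1) (s3 * s0)
  | DisjointType =>
    coef_vec (- s5 * s2 - s6 * s4) s6 (- s7 * s1 - s8 * s3) s7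
             (- s5 * s1 - s6 * s3) s5 (- s7 * s2 - s8 * s4) s8
  | TwoType =>
    coef_vec s3 s4 s5 s6 (- s3 * s1 - s1 * s2 * (s5 + s7 * s1))
             (- s4 * s2 - s1 * s2 * (s6 + s8 * s2)) s7 s8
  | OneType =>
    coef_vec s5 (s1 * s0 + s7 * s2) (s8 * s4 - s6 * s0) (- s1 - s8 * s3)
             (s7 * s4 - s5 * s0) (- s7 * s3) s6 (s8 * s2)
  end.

Lemma family_lies_on ty s : lies_on (family_p ty s) (family_t ty s).
Proof.
rewrite /family_p /family_t.
move: (s 0 0) (s 0 1) (s 0 2) (s 0 3) (s 0 4) (s 0 5) (s 0 6) (s 0 7) (s 0 8).
move=> k0 k1 k2 k3 k4 k5 k6 k7 k8.
split=> [|u]; first by case: ty; rewrite plucker_relationE; ring.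
rewrite (point_vecE u); move: (u 0 0) (u 1 0) (u 2 0) (u 3 0) => u0 u1 u2 u3.
by case: ty; rewrite plucker_mxE octanomialE; ring.
Qed.

Definition params_vec (k0 k1 k2 k3 k4 k5 k6 k7 k8 : R) : 'rV[R]_9 :=
  \row_j [:: k0; k1; k2; k3; k4; k5; k6; k7; k8]`_j.

Lemma params_vec_coord k0 k1 k2 k3 k4 k5 k6 k7 k8 :
  let s := params_vec k0 k1 k2 k3 k4 k5 k6 k7 k8 in
  ((s 0 0 = k0) * (s 0 1 = k1) * (s 0 2 = k2) * (s 0 3 = k3) * (s 0 4 = k4) *
   (s 0 5 = k5) * (s 0 6 = k6) * (s 0 7 = k7) * (s 0 8 = k8))%type.
Proof. by rewrite /= !mxE. Qed.

Definition in_family ty p t :=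
  exists s, p = family_p ty s /\ t = family_t ty s.

Definition in_component k p t :=
  in_family (component_type k) (unact_p (component_sym k) p)
            (unact_t (component_sym k) t).

End Families.

Lemma map_family_p (R S : comNzRingType) (f : {rmorphism R -> S}) ty s :
  map_mx f (family_p ty s) = family_p ty (map_mx f s).
Proof.
by case: ty; rewrite /family_p map_plucker_vec !mxE
  ?(rmorphD, rmorphB, rmorphM, rmorphN, rmorph0).
Qed.

Lemma map_family_t (R S : comNzRingType) (f : {rmorphism R -> S}) ty s :
  map_mx f (family_t ty s) = family_t ty (map_mx f s).
Proof.
by case: ty; rewrite /family_t map_coef_vec !mxE
  ?(rmorphD, rmorphB, rmorphM, rmorphN, rmorph0).
Qed.

(** * Every line on an octanomial surface lies in a family *)

Section LinearCombination.
Variable R : comNzRingType.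
Implicit Types x y k e : R.

Lemma eq_comb1 k1 e1 x y : e1 = 0 -> x - y = k1 * e1 -> x = y.
Proof. by move=> ->; rewrite mulr0 => /subr0_eq. Qed.

Lemma eq_comb2 k1 k2 e1 e2 x y :
  e1 = 0 -> e2 = 0 -> x - y = k1 * e1 + k2 * e2 -> x = y.
Proof. by move=> -> ->; rewrite !mulr0 addr0 => /subr0_eq. Qed.

Lemma eq_comb3 k1 k2 k3 e1 e2 e3 x y : e1 = 0 -> e2 = 0 -> e3 = 0 ->
  x - y = k1 * e1 + k2 * e2 + k3 * e3 -> x = y.
Proof. by move=> -> -> ->; rewrite !mulr0 !addr0 => /subr0_eq. Qed.

End LinearCombination.

Section Covering.
Variable K : fieldType.
Hypothesis nz2 : (2 : K) != 0.

Lemma mulf0_r (x y : K) : x != 0 -> x * y = 0 -> y = 0.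
Proof. by move=> nzx /eqP; rewrite mulf_eq0 (negPf nzx) => /eqP. Qed.

(** The values at (1, 0), (0, 1), (1, 1) and (1, - 1) determine a binary
    cubic, given that 2 is invertible. *)
Lemma binary_cubic_eq0 (c0 c1 c2 c3 : K) :
    (forall r s, c0 * r ^+ 3 + c1 * r ^+ 2 * s + c2 * r * s ^+ 2
                 + c3 * s ^+ 3 = 0) ->
  [/\ c0 = 0, c1 = 0, c2 = 0 & c3 = 0].
Proof.
move=> cub.
have c0_0 : c0 = 0 by apply: (eq_comb1 (k1 := 1) (cub 1 0)); ring.
have c3_0 : c3 = 0 by apply: (eq_comb1 (k1 := 1) (cub 0 1)); ring.
have cubp := cub 1 1; have cubm := cub 1 (-1).
have c1_0 : c1 = 0.
  apply: (mulf0_r nz2).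
  by apply: (eq_comb3 (k1 := 1) (k2 := -1) (k3 := -2) cubp cubm c3_0); ring.
have c2_0 : c2 = 0.
  apply: (mulf0_r nz2).
  by apply: (eq_comb3 (k1 := 1) (k2 := 1) (k3 := -2) cubp cubm c0_0); ring.
by [].
Qed.

Variables a b c d e f g h : K.
Let t := coef_vec a b c d e f g h.

Lemma lies_onP p01 p02 p03 p12 p13 p23 :
    lies_on (plucker_vec p01 p02 p03 p12 p13 p23) t ->
  p01 * p23 - p02 * p13 + p03 * p12 = 0 /\
  forall u0 u1 u2 u3,
    (p01 * u1 + p02 * u2 + p03 * u3) * (- p01 * u0 + p12 * u2 + p13 * u3) *
    (e * (p01 * u1 + p02 * u2 + p03 * u3) +
     f * (- p01 * u0 + p12 * u2 + p13 * u3) +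
     a * (- p02 * u0 - p12 * u1 + p23 * u3) +
     b * (- p03 * u0 - p13 * u1 - p23 * u2)) +
    (- p02 * u0 - p12 * u1 + p23 * u3) * (- p03 * u0 - p13 * u1 - p23 * u2) *
    (c * (p01 * u1 + p02 * u2 + p03 * u3) +
     d * (- p01 * u0 + p12 * u2 + p13 * u3) +
     g * (- p02 * u0 - p12 * u1 + p23 * u3) +
     h * (- p03 * u0 - p13 * u1 - p23 * u2)) = 0.
Proof.
case=> plu cub; split=> [|u0 u1 u2 u3]; first by rewrite -plucker_relationE.
by have := cub (point_vec u0 u1 u2 u3); rewrite plucker_mxE octanomialE.
Qed.

(** On a line in the plane x = 0 the cubic is z w l2, so that l2 vanishes
    unless z or w does; the last two cases are x = z = 0 and x = w = 0. *)
Lemma cover_plane p12 p13 p23 :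
    lies_on (plucker_vec 0 0 0 p12 p13 p23) t ->
  [\/ in_family PlaneType (plucker_vec 0 0 0 p12 p13 p23) t,
      p13 = 0 /\ p23 = 0 | p12 = 0 /\ p23 = 0].
Proof.
case/lies_onP => _ cub.
suff [[mu [hE gE dE]]|deg|deg] :
  [\/ exists mu, [/\ h = mu * p12, g = - mu * p13 & d = mu * p23],
      p13 = 0 /\ p23 = 0 | p12 = 0 /\ p23 = 0];
  [apply: Or31|exact: Or32|exact: Or33|].
  exists (params_vec p12 p13 p23 mu a b c e f).
  by rewrite /family_p /family_t !params_vec_coord /t hE gE dE.
have [p23_0 | p23_nz] := eqVneq p23 0; last first.
  have [|_ eq1 eq2 _] := @binary_cubic_eq0 0 (p23 ^+ 2 * (d * p13 + g * p23))
    (p23 ^+ 2 * (h * p23 - d * p12)) 0.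
    by move=> r s; apply: (eq_comb1 (k1 := 1) (cub 0 0 (- s) r)); ring.
  have {}eq1 := mulf0_r (expf_neq0 2 p23_nz) eq1.
  have {}eq2 := mulf0_r (expf_neq0 2 p23_nz) eq2.
  apply: Or31; exists (d / p23); split.
  - by apply: (eq_comb1 (k1 := p23^-1) eq2); field.
  - by apply: (eq_comb1 (k1 := p23^-1) eq1); field.
  - by field.
have [p12_0 | p12_nz] := eqVneq p12 0; first exact: Or33.
have [p13_0 | p13_nz] := eqVneq p13 0; first exact: Or32.
have nz := mulf_neq0 p12_nz p13_nz.
have [|_ _ eq1 eq2] := @binary_cubic_eq0 0 0 (p12 * p13 * (d * p12))
    (p12 * p13 * (g * p12 + h * p13)).
  move=> r s; rewrite p23_0 in cub.
  by apply: (eq_comb1 (k1 := 1) (cub 0 (- s) r 0)); ring.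
have {}eq1 := mulf0_r nz eq1; have {}eq2 := mulf0_r nz eq2.
apply: Or31; exists (h / p12); rewrite p23_0; split.
- by field.
- by apply: (eq_comb1 (k1 := p12^-1) eq2); field.
- by apply: (eq_comb1 (k1 := p12^-1) eq1); field.
Qed.

(** By the second hypothesis x y and z w are coprime quadrics on the line, so
    that x y l1 + z w l2 = 0 makes the linear form l1 divisible by z w, hence
    zero. *)
Lemma cover_disjoint p01 p02 p03 p12 p13 p23 :
    lies_on (plucker_vec p01 p02 p03 p12 p13 p23) t ->
    [&& p02 != 0, p03 != 0, p12 != 0 & p13 != 0] ->
  in_family DisjointType (plucker_vec p01 p02 p03 p12 p13 p23) t.
Proof.
case/lies_onP => plu cub /and4P[p02_nz p03_nz p12_nz p13_nz].
(* On the line, x and z serve as coordinates p02 * r and p02 * s. *)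
pose l1 := e * p02 + f * p12 - b * p23; pose l2 := f * p01 + a * p02 + b * p03.
pose n1 := c * p02 + d * p12 - h * p23; pose n2 := d * p01 + g * p02 + h * p03.
have [|eq0 eq1 eq2 eq3] := @binary_cubic_eq0 (p02 * (p12 * l1))
    (p02 * (p12 * l2 + p01 * l1 - p23 * n1))
    (p02 * (p01 * l2 - p23 * n2 + p03 * n1)) (p02 * (p03 * n2)).
  move=> r s; apply: (eq_comb1 (k1 := 1) (cub (- s) 0 r 0)).
  by rewrite /l1 /l2 /n1 /n2; ring.
have l1_0 := mulf0_r p12_nz (mulf0_r p02_nz eq0).
have n2_0 := mulf0_r p03_nz (mulf0_r p02_nz eq3).
have {}eq1 := mulf0_r p02_nz eq1; have {}eq2 := mulf0_r p02_nz eq2.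
have nz := mulf_neq0 p02_nz p13_nz.
rewrite l1_0 n2_0 in eq1 eq2.
have n1_0 : n1 = 0.
  apply: (mulf0_r nz).
  by apply: (eq_comb3 (k1 := p12) (k2 := - p01) (k3 := - n1) eq2 eq1 plu); ring.
have l2_0 : l2 = 0.
  apply: (mulf0_r nz).
  by apply: (eq_comb3 (k1 := p23) (k2 := p03) (k3 := - l2) eq2 eq1 plu); ring.
exists (params_vec p02 (p12 / p02) (p01 / p02) (- p23 / p02) (p03 / p02)
  f b d h).
rewrite /family_p /family_t !params_vec_coord /t; split.
  congr plucker_vec; try by field.
  by apply: (eq_comb1 (k1 := - p02^-1) plu); field.
congr coef_vec.
- by apply: (eq_comb1 (k1 := p02^-1) l2_0); rewrite /l2; field.
- by apply: (eq_comb1 (k1 := p02^-1) n1_0); rewrite /n1; field.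
- by apply: (eq_comb1 (k1 := p02^-1) l1_0); rewrite /l1; field.
- by apply: (eq_comb1 (k1 := p02^-1) n2_0); rewrite /n2; field.
Qed.

(** With z = be * x and w = de * y on the line, the cubic is x y times
    l1 + be * de * l2. *)
Lemma two_meeting_params p01 p03 p12 p23 :
    lies_on (plucker_vec p01 0 p03 p12 0 p23) t ->
    [&& p01 != 0, p03 != 0, p12 != 0 & p23 != 0] ->
  in_family TwoType (plucker_vec p01 0 p03 p12 0 p23) t.
Proof.
case/lies_onP => plu cub /and4P[p01_nz p03_nz p12_nz p23_nz].
pose be := - p12 / p01; pose de := p03 / p01.
have [|_ eq1 eq2 _] := @binary_cubic_eq0 0
    (p01 ^+ 3 * (e + a * be + be * de * (c + g * be)))
    (p01 ^+ 3 * (f + b * de + be * de * (d + h * de))) 0.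
  move=> r s; have {}cub := cub (- s) r 0 0; rewrite -[RHS]cub /be /de.
  by field.
have {}eq1 := mulf0_r (expf_neq0 3 p01_nz) eq1.
have {}eq2 := mulf0_r (expf_neq0 3 p01_nz) eq2.
exists (params_vec p01 be de a b c d g h).
rewrite /family_p /family_t !params_vec_coord /t; split.
  rewrite /be /de; congr plucker_vec; try by field.
  by apply: (eq_comb1 (k1 := p01^-1) plu); field.
congr coef_vec.
- by apply: (eq_comb1 (k1 := 1) eq1); ring.
- by apply: (eq_comb1 (k1 := 1) eq2); ring.
Qed.

(** With z = be * x on the line, the cubic is x times y l1 + be * w l2.  Since
    y and w are independent on the line, l1 is a multiple of w and l2 the
    opposite multiple of y. *)
Lemma one_meeting_params be p01 p03 p13 :
    lies_on (plucker_vec p01 0 p03 (- be * p01) p13 (be * p03)) t ->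
    be != 0 -> p13 != 0 -> (p01 != 0) || (p03 != 0) ->
  in_family OneType (plucker_vec p01 0 p03 (- be * p01) p13 (be * p03)) t.
Proof.
case/lies_onP => plu cub be_nz p13_nz p0_nz.
pose l1 := e * p03 + f * p13 + a * be * p03.
pose l2 := - e * p01 - a * be * p01 + b * p13.
pose n1 := c * p03 + d * p13 + g * be * p03.
pose n2 := - c * p01 - g * be * p01 + h * p13.
pose q := l2 + be * n1.
have [|eq0 eq1 eq2 eq3] := @binary_cubic_eq0 (p13 * (p03 * l1))
    (p13 * (p03 * q - p01 * l1)) (p13 * (p03 * (be * n2) - p01 * q))
    (p13 * (- p01 * (be * n2))).
  move=> r s; apply: (eq_comb1 (k1 := 1) (cub 0 (- s) 0 r)).
  by rewrite /q /l1 /l2 /n1 /n2; ring.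
have {}eq0 := mulf0_r p13_nz eq0; have {}eq1 := mulf0_r p13_nz eq1.
have {}eq2 := mulf0_r p13_nz eq2; have {}eq3 := mulf0_r p13_nz eq3.
have [l1_0 q_0 n2_0] : [/\ l1 = 0, q = 0 & n2 = 0].
  have [p03_0 | p03_nz] := eqVneq p03 0; last first.
    have l1_0 := mulf0_r p03_nz eq0.
    rewrite l1_0 mulr0 subr0 in eq1; have q_0 := mulf0_r p03_nz eq1.
    rewrite q_0 mulr0 subr0 in eq2.
    by split=> //; apply: (mulf0_r be_nz); apply: (mulf0_r p03_nz).
  rewrite p03_0 !mul0r !sub0r in eq1 eq2.
  have p01_nz : - p01 != 0 by move: p0_nz; rewrite p03_0 eqxx orbF oppr_eq0.
  rewrite -!mulNr in eq1 eq2; split; try exact: (mulf0_r p01_nz).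
  by apply: (mulf0_r be_nz); apply: (mulf0_r p01_nz).
exists (params_vec be (- n1 / p13) p01 p03 p13 a g
  ((e + a * be) / p13) ((c + g * be) / p13)).
rewrite /family_p /family_t !params_vec_coord /t; split=> //.
congr coef_vec.
- by apply: (eq_comb1 (k1 := p13^-1) q_0); rewrite /q /l2; field.
- by field.
- by rewrite /n1; field.
- by field.
- by apply: (eq_comb1 (k1 := p13^-1) l1_0); rewrite /l1; field.
- by apply: (eq_comb1 (k1 := p13^-1) n2_0); rewrite /n2; field.
Qed.

End Covering.

Section SymmetriesE.
Variable R : comNzRingType.

Lemma swap_xy_pE (p01 p02 p03 p12 p13 p23 : R) :
  swap_xy_p (plucker_vec p01 p02 p03 p12 p13 p23) =
  plucker_vec (- p01) p12 p13 p02 p03 p23.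
Proof. by rewrite /swap_xy_p !plucker_vec_coord. Qed.

Lemma swap_zw_pE (p01 p02 p03 p12 p13 p23 : R) :
  swap_zw_p (plucker_vec p01 p02 p03 p12 p13 p23) =
  plucker_vec p01 p03 p02 p13 p12 (- p23).
Proof. by rewrite /swap_zw_p !plucker_vec_coord. Qed.

Lemma swap_pairs_pE (p01 p02 p03 p12 p13 p23 : R) :
  swap_pairs_p (plucker_vec p01 p02 p03 p12 p13 p23) =
  plucker_vec p23 (- p02) (- p12) (- p03) (- p13) p01.
Proof. by rewrite /swap_pairs_p !plucker_vec_coord. Qed.

Definition swap_pE := (swap_xy_pE, swap_zw_pE, swap_pairs_pE).

Lemma in_family_coord (l : R) (t : 'rV[R]_8) :
  in_family CoordType (plucker_vec 0 0 0 0 l 0) t.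
Proof.
exists (params_vec l (t 0 0) (t 0 1) (t 0 2) (t 0 3)
  (t 0 4) (t 0 5) (t 0 6) (t 0 7)).
by rewrite /family_p /family_t !params_vec_coord -coef_vecE.
Qed.

End SymmetriesE.

Section CoveringTheorem.
Variable K : fieldType.
Hypothesis nz2 : (2 : K) != 0.

(** The last hypothesis says that none of x, y, z, w vanishes on the line.
    Now x and z are multiples of one form, and y and w of another one,
    so that the four remaining Plücker coordinates are products of nonzero
    factors. *)
Lemma cover_two_meeting (p01 p02 p03 p12 p13 p23 : K) t :
    lies_on (plucker_vec p01 p02 p03 p12 p13 p23) t -> p02 = 0 -> p13 = 0 ->
    [&& (p01 != 0) || (p03 != 0), (p01 != 0) || (p12 != 0),
        (p12 != 0) || (p23 != 0) & (p03 != 0) || (p23 != 0)] ->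
  in_family TwoType (plucker_vec p01 p02 p03 p12 p13 p23) t.
Proof.
move=> on_pt p02_0 p13_0; move: on_pt; rewrite {}p02_0 {}p13_0 (coef_vecE t).
move=> on_pt /and4P[nzx nzy nzz nzw]; apply: two_meeting_params => //.
have [plu _] := lies_onP on_pt; rewrite mul0r subr0 in plu.
have nz_p01 : p01 != 0.
  apply/eqP => p01_0; move: nzx nzy plu; rewrite p01_0 eqxx /= mul0r add0r.
  by move=> nz3 nz2' /eqP; rewrite mulf_eq0 (negPf nz3) (negPf nz2').
have nz_p23 : p23 != 0.
  apply/eqP => p23_0; move: nzz nzw plu; rewrite p23_0 eqxx !orbF mulr0 add0r.
  by move=> nz3 nz2' /eqP; rewrite mulf_eq0 (negPf nz3) (negPf nz2').
have: p03 * p12 != 0.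
  by rewrite -(addKr (p01 * p23) (p03 * p12)) plu addr0 oppr_eq0 mulf_neq0.
by rewrite mulf_eq0 negb_or => /andP[-> ->]; rewrite nz_p01 nz_p23.
Qed.

Lemma cover_one_meeting (p01 p02 p03 p12 p13 p23 : K) t :
    lies_on (plucker_vec p01 p02 p03 p12 p13 p23) t -> p02 = 0 -> p13 != 0 ->
    (p01 != 0) || (p03 != 0) -> (p12 != 0) || (p23 != 0) ->
  in_family OneType (plucker_vec p01 p02 p03 p12 p13 p23) t.
Proof.
move=> on_pt p02_0 p13_nz nzx nzz; move: on_pt; rewrite {}p02_0 (coef_vecE t).
move=> on_pt; have [plu _] := lies_onP on_pt; rewrite mul0r subr0 in plu.
(* The forms x and z are proportional on the line: z = be * x. *)
have [be [p12E p23E]] : exists be, p12 = - be * p01 /\ p23 = be * p03.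
  have [p01_0 | p01_nz] := eqVneq p01 0; last first.
    exists (- p12 / p01); split; first by field.
    by apply: (eq_comb1 (k1 := p01^-1) plu); field.
  rewrite p01_0 eqxx /= in nzx; exists (p23 / p03).
  rewrite p01_0 mul0r add0r in plu.
  by split; [rewrite p01_0 mulr0; apply: mulf0_r plu | field].
move: on_pt nzz; rewrite p12E p23E => on_pt nzz.
apply: one_meeting_params => //; apply: contraTneq nzz => ->.
by rewrite oppr0 !mul0r eqxx.
Qed.

(** The cases are first whether one of x, y, z, w vanishes on the line, then
    which of p02, p03, p12, p13 vanish; each case is moved to the model of its
    family by a symmetry. *)
Lemma on_some_component (p : 'rV[K]_6) (T : 'rV[K]_8) :
  lies_on p T -> exists k, in_component k p T.
Proof.
rewrite (plucker_vecE p).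
move: (p 0 0) (p 0 1) (p 0 2) (p 0 3) (p 0 4) (p 0 5).
move=> p01 p02 p03 p12 p13 p23.
pose i0 := @Ordinal 4 0 isT; pose i1 := @Ordinal 4 1 isT.
pose i2 := @Ordinal 4 2 isT; pose i3 := @Ordinal 4 3 isT.
have coord0 t (l : K) :
    exists k, in_component k (plucker_vec 0 0 0 0 l 0) t.
  by exists (CoordLine i0); exact: in_family_coord.
have coord1 t (l : K) :
    exists k, in_component k (plucker_vec 0 0 0 l 0 0) t.
  exists (CoordLine i1); rewrite /in_component /= !swap_pE oppr0.
  exact: in_family_coord.
have coord2 t (l : K) :
    exists k, in_component k (plucker_vec 0 0 l 0 0 0) t.
  exists (CoordLine i2); rewrite /in_component /= !swap_pE oppr0.
  exact: in_family_coord.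
have coord3 t (l : K) :
    exists k, in_component k (plucker_vec 0 l 0 0 0 0) t.
  exists (CoordLine i3); rewrite /in_component /= !swap_pE !oppr0.
  exact: in_family_coord.
move=> on_pt.
have [/and3P[/eqP p01_0 /eqP p02_0 /eqP p03_0] | nzx] :=
    boolP [&& p01 == 0, p02 == 0 & p03 == 0].
  move: on_pt; rewrite p01_0 p02_0 p03_0 (coef_vecE T).
  case/(cover_plane nz2) => [fam | [-> ->] | [-> ->]] //.
  by exists (PlaneLine i0).
have [/and3P[/eqP p01_0 /eqP p12_0 /eqP p13_0] | nzy] :=
    boolP [&& p01 == 0, p12 == 0 & p13 == 0].
  have := unact_lies_on (true, false, false) on_pt.
  rewrite /= swap_pE p01_0 p12_0 p13_0 oppr0 (coef_vecE (swap_xy_t T)).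
  case/(cover_plane nz2) => [fam | [-> ->] | [-> ->]] //.
  exists (PlaneLine i1); rewrite /in_component /= swap_pE oppr0.
  by rewrite (coef_vecE (swap_xy_t T)).
have [/and3P[/eqP p02_0 /eqP p12_0 /eqP p23_0] | nzz] :=
    boolP [&& p02 == 0, p12 == 0 & p23 == 0].
  have := unact_lies_on (false, false, true) on_pt.
  rewrite /= swap_pE p02_0 p12_0 p23_0 oppr0 (coef_vecE (swap_pairs_t T)).
  case/(cover_plane nz2) => [fam | [/eqP + ->] | [/eqP + ->]];
    rewrite ?oppr_eq0; try by move=> /eqP ->.
  exists (PlaneLine i2); rewrite /in_component /= swap_pE oppr0.
  by rewrite (coef_vecE (swap_pairs_t T)).
have [/and3P[/eqP p03_0 /eqP p13_0 /eqP p23_0] | nzw] :=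
    boolP [&& p03 == 0, p13 == 0 & p23 == 0].
  have := unact_lies_on (false, true, true) on_pt.
  rewrite /= !swap_pE p03_0 p13_0 p23_0 !oppr0.
  rewrite (coef_vecE (swap_pairs_t _)).
  case/(cover_plane nz2) => [fam | [/eqP + ->] | [/eqP + ->]];
    rewrite ?oppr_eq0; try by move=> /eqP ->.
  exists (PlaneLine i3); rewrite /in_component /= !swap_pE !oppr0.
  by rewrite (coef_vecE (swap_pairs_t _)).
have nzN q : (- q != 0 :> K) = (q != 0) by rewrite oppr_eq0.
have [p02_0 | p02_nz] := eqVneq p02 0.
  have [p13_0 | p13_nz] := eqVneq p13 0.
    exists (TwoMeeting (@Ordinal 2 0 isT)); apply: cover_two_meeting => //.
    by move: nzx nzy nzz nzw; rewrite p02_0 p13_0 !eqxx /= !andbT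
      !negb_and => -> -> -> ->.
  exists (OneMeeting i0); apply: cover_one_meeting => //.
    by move: nzx; rewrite p02_0 eqxx /= negb_and.
  by move: nzz; rewrite p02_0 eqxx /= negb_and.
have [p03_0 | p03_nz] := eqVneq p03 0.
  have := unact_lies_on (false, true, false) on_pt; rewrite /= swap_pE => on'.
  have [p12_0 | p12_nz] := eqVneq p12 0.
    exists (TwoMeeting (@Ordinal 2 1 isT)); rewrite /in_component /= swap_pE.
    apply: cover_two_meeting => //; rewrite !nzN.
    by move: nzx nzy nzz nzw; rewrite p03_0 p12_0 !eqxx /= !andbT
      !negb_and => -> -> -> ->.
  exists (OneMeeting i1); rewrite /in_component /= swap_pE.
  apply: cover_one_meeting => //; rewrite ?nzN.
    by move: nzx; rewrite p03_0 eqxx /= andbT negb_and.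
  by move: nzw; rewrite p03_0 eqxx /= negb_and.
have [p12_0 | p12_nz] := eqVneq p12 0.
  have := unact_lies_on (true, false, false) on_pt; rewrite /= swap_pE => on'.
  exists (OneMeeting i2); rewrite /in_component /= swap_pE.
  apply: cover_one_meeting => //; rewrite ?nzN.
    by move: nzy; rewrite p12_0 eqxx /= negb_and.
  by move: nzz; rewrite p12_0 eqxx /= negb_and.
have [p13_0 | p13_nz] := eqVneq p13 0.
  have := unact_lies_on (true, true, false) on_pt; rewrite /= !swap_pE => on'.
  exists (OneMeeting i3); rewrite /in_component /= !swap_pE.
  apply: cover_one_meeting => //; rewrite ?nzN.
    by move: nzy; rewrite p13_0 eqxx /= andbT negb_and.
  by move: nzw; rewrite p13_0 eqxx /= negb_and.
exists DisjointLine; move: on_pt; rewrite /in_component /= (coef_vecE T).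
by move=> on_pt; apply: cover_disjoint => //; apply/and4P.
Qed.

End CoveringTheorem.

(** * The minimal primes *)

(** The generic point of affine 9-space. *)
Definition generic_params : 'rV[{mpoly rat[9]}]_9 := \row_i 'X_i.

Definition generic_p k := act_p (component_sym k)
  (family_p (component_type k) generic_params).
Definition generic_t k := act_t (component_sym k)
  (family_t (component_type k) generic_params).

Definition component_eval k : {rmorphism ufv_ring -> {mpoly rat[9]}} :=
  eval_at (@mpolyC 9 rat) (generic_p k) (generic_t k).

Lemma component_eval_p k : map_mx (component_eval k) p_vars = generic_p k.
Proof. exact: eval_at_p. Qed.

Lemma component_eval_t k : map_mx (component_eval k) t_vars = generic_t k.
Proof. exact: eval_at_t. Qed.

Definition component_ideal k : set ufv_ring :=
  [set q | component_eval k q = 0].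

Lemma component_ideal_prime k : prime_ideal (component_ideal k).
Proof.
rewrite /prime_ideal; split; first split.
- by rewrite unfold_in; apply/mem_set; exact: rmorph0.
- rewrite unfold_in; apply/negP => /set_mem /eqP.
  by rewrite rmorph1 oner_eq0.
- move=> a u v; rewrite !unfold_in => /set_mem u0 /set_mem v0; apply/mem_set.
  by rewrite /component_ideal /= rmorphD rmorphM u0 v0 mulr0 addr0.
- move=> u v; rewrite !unfold_in => /set_mem /= /eqP.
  rewrite rmorphM mulf_eq0 => /orP[] /eqP uv0; apply/orP; [left|right];
    exact/mem_set.
Qed.

Lemma I_ufv_sub_component k : I_ufv `<=` component_ideal k.
Proof.
have [_ ker] := I_ufv_sub_kernel (component_eval k); apply: ker.
rewrite component_eval_p component_eval_t /generic_p /generic_t.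
have := family_lies_on (component_type k) generic_params.
move=> /(act_lies_on (component_sym k)) [-> _]; split=> //.
rewrite map_act_p map_act_t map_family_p map_family_t.
have := family_lies_on (component_type k)
  (map_mx (@mpolyC 4 {mpoly rat[9]}) generic_params).
by move=> /(act_lies_on (component_sym k)) [_ ->].
Qed.

(** A morphism at a point of the image of the parametrisation factors through
    the evaluation at the generic point of the component. *)
Lemma component_ideal_vanish k (R : comUnitRingType)
    (ev : {rmorphism ufv_ring -> R}) :
    in_component k (map_mx ev p_vars) (map_mx ev t_vars) ->
  forall q, component_ideal k q -> ev q = 0.
Proof.
case=> s [pE tE] q kq.
pose evC : {rmorphism rat -> R} := ev \o @mpolyC _ rat.
pose eta : {rmorphism {mpoly rat[9]} -> R} := mmap evC (fun i => s 0 i).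
have etaX : map_mx eta generic_params = s.
  by apply/rowP => i; rewrite !mxE [LHS]mmapX mmap1U.
have evE : ev =1 (eta \o component_eval k)%FUN.
  have mapE n (A : 'rV[ufv_ring]_n) : map_mx (eta \o component_eval k)%FUN A =
      map_mx eta (map_mx (component_eval k) A).
    by apply/rowP => i; rewrite !mxE.
  apply: ufv_morphism_ext; rewrite [RHS]mapE.
    by rewrite component_eval_p map_act_p map_family_p etaX -pE unact_pK.
  by rewrite component_eval_t map_act_t map_family_t etaX -tE unact_tK.
by rewrite evE /= [component_eval k q]kq rmorph0.
Qed.

(** The generic point of the prime, with coordinates in the residue field, is
    a point of the variety, hence lies on some component. *)
Lemma prime_over_I_ufv Q : prime_ideal Q -> I_ufv `<=` Q ->
  exists k, component_ideal k `<=` Q.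
Proof.
move=> [idQ prQ] IQ; pose P : ufv_ring -> bool := fun x => x \in Q.
pose J : prime_idealr ufv_ring := HB.pack P
  (isIdealr.Build ufv_ring P idQ) (isPrimeIdealrClosed.Build ufv_ring P prQ).
have [K [ev evE]] := residue_field J.
have evQ q : ev q = 0 <-> Q q.
  by rewrite evE unfold_in; split=> [/set_mem|/mem_set].
have nz2 : (2 : K) != 0.
  rewrite -[2]/(2%:R) -(rmorph_nat (ev \o @mpolyC _ rat)%FUN) fmorph_eq0.
  by rewrite pnatr_eq0.
have on_pt : lies_on (map_mx ev p_vars) (map_mx ev t_vars).
  by apply: I_ufv_lies_on => q /IQ /evQ.
have [k in_k] := on_some_component nz2 on_pt.
by exists k => q /(component_ideal_vanish in_k)/evQ.
Qed.

(** * Incidence of lines *)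

Section Lines.
Variable K : fieldType.

Lemma plucker_vec0 : plucker_vec 0 0 0 0 0 0 = 0 :> 'rV[K]_6.
Proof. by rewrite [RHS]plucker_vecE !mxE. Qed.

Lemma point_vec0 : point_vec 0 0 0 0 = 0 :> 'cV[K]_4.
Proof. by rewrite [RHS]point_vecE !mxE. Qed.

Lemma plucker_vec_neq0 (p01 p02 p03 p12 p13 p23 : K) :
  (plucker_vec p01 p02 p03 p12 p13 p23 != 0 :> 'rV[K]_6) =
  [|| p01 != 0, p02 != 0, p03 != 0, p12 != 0, p13 != 0 | p23 != 0].
Proof.
apply/idP/idP; last first.
  apply: contraTT; rewrite negbK => /eqP p0.
  have := plucker_vec_coord p01 p02 p03 p12 p13 p23; rewrite p0 /= !mxE.
  by case=> -[[[[<- <-] <-] <-] <-] <-; rewrite eqxx.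
apply: contraNT; rewrite !negb_or !negbK.
by case/and5P => /eqP-> /eqP-> /eqP-> /eqP-> /andP[/eqP-> /eqP->];
  rewrite plucker_vec0.
Qed.

Lemma point_vec_neq0 (x y z w : K) :
  (point_vec x y z w != 0 :> 'cV[K]_4) =
  [|| x != 0, y != 0, z != 0 | w != 0].
Proof.
apply/idP/idP; last first.
  apply: contraTT; rewrite negbK => /eqP v0.
  have := point_vec_coord x y z w; rewrite v0 /= !mxE.
  by case=> -[[<- <-] <-] <-; rewrite eqxx.
apply: contraNT; rewrite !negb_or !negbK.
by case/and4P => /eqP-> /eqP-> /eqP-> /eqP->; rewrite point_vec0.
Qed.

(** By the Plücker relation the image of the matrix of p is the kernel of the
    dual skew-symmetric matrix. *)
Lemma line_of_incidence (p01 p02 p03 p12 p13 p23 x y z w : K) :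
    let p := plucker_vec p01 p02 p03 p12 p13 p23 in
    p != 0 -> plucker_relation p = 0 ->
  line_of p (point_vec x y z w) <->
  [/\ p01 * z - p02 * y + p12 * x = 0, p01 * w - p03 * y + p13 * x = 0,
      p02 * w - p03 * z + p23 * x = 0 & p12 * w - p13 * z + p23 * y = 0].
Proof.
rewrite /= plucker_vec_neq0 plucker_relationE => nzp plu; split.
  case=> u; rewrite (point_vecE u) plucker_mxE => /colP vE.
  have := (vE 0, vE 1, vE 2, vE 3); rewrite !point_vec_coord.
  move: (u 0 0) (u 1 0) (u 2 0) (u 3 0) => u0 u1 u2 u3 [[[-> ->] ->] ->].
  split.
  - by apply: (eq_comb1 (k1 := u3) plu); ring.
  - by apply: (eq_comb1 (k1 := - u2) plu); ring.
  - by apply: (eq_comb1 (k1 := u1) plu); ring.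
  - by apply: (eq_comb1 (k1 := - u0) plu); ring.
case=> e012 e013 e023 e123.
have line u0 u1 u2 u3 :
    p01 * u1 + p02 * u2 + p03 * u3 = x ->
    - p01 * u0 + p12 * u2 + p13 * u3 = y ->
    - p02 * u0 - p12 * u1 + p23 * u3 = z ->
    - p03 * u0 - p13 * u1 - p23 * u2 = w ->
    line_of (plucker_vec p01 p02 p03 p12 p13 p23) (point_vec x y z w).
  by move=> <- <- <- <-; exists (point_vec u0 u1 u2 u3); rewrite plucker_mxE.
case/or4P: nzp => [nz|nz|nz|/or3P[nz|nz|nz]].
- apply: (line (- y / p01) (x / p01) 0 0); try by field.
  + by apply: (eq_comb1 (k1 := - p01^-1) e012); field.
  + by apply: (eq_comb1 (k1 := - p01^-1) e013); field.
- apply: (line (- z / p02) 0 (x / p02) 0); try by field.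
  + by apply: (eq_comb1 (k1 := p02^-1) e012); field.
  + by apply: (eq_comb1 (k1 := - p02^-1) e023); field.
- apply: (line (- w / p03) 0 0 (x / p03)); try by field.
  + by apply: (eq_comb1 (k1 := p03^-1) e013); field.
  + by apply: (eq_comb1 (k1 := p03^-1) e023); field.
- apply: (line 0 (- z / p12) (y / p12) 0); try by field.
  + by apply: (eq_comb1 (k1 := - p12^-1) e012); field.
  + by apply: (eq_comb1 (k1 := - p12^-1) e123); field.
- apply: (line 0 (- w / p13) 0 (y / p13)); try by field.
  + by apply: (eq_comb1 (k1 := - p13^-1) e013); field.
  + by apply: (eq_comb1 (k1 := p13^-1) e123); field.
- apply: (line 0 0 (- w / p23) (z / p23)); try by field.
  + by apply: (eq_comb1 (k1 := - p23^-1) e023); field.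
  + by apply: (eq_comb1 (k1 := - p23^-1) e123); field.
Qed.

(** The pairs of indices in the order of the Plücker coordinates. *)
Definition coordinate_pair (j : 'I_6) : {set 'I_4} :=
  nth finset.set0 [:: [set 0; 1]; [set 0; 2]; [set 0; 3];
                      [set 1; 2]; [set 1; 3]; [set 2; 3]]%SET j.

Lemma coordinate_pairP (S : {set 'I_4}) :
  #|S| = 2%N -> exists j, S = coordinate_pair j.
Proof.
move/eqP/cards2P => [i [j [ne_ij ->]]].
have pick (k : nat) (lt_k6 : (k < 6)%N) (S' : {set 'I_4}) :
    S' = coordinate_pair (Ordinal lt_k6) ->
    exists j, S' = coordinate_pair j by exists (Ordinal lt_k6).
have pairE (i1 j1 i2 j2 : 'I_4) :
    i1 = i2 /\ j1 = j2 \/ i1 = j2 /\ j1 = i2 ->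
    ([set i1; j1] = [set i2; j2])%SET.
  by case=> -[-> ->] //; rewrite finset.setUC.
move: i j ne_ij => [[|[|[|[|//]]]] lti] [[|[|[|[|//]]]] ltj] // _.
- by apply: (pick 0 isT); apply: pairE; left; split; apply/val_inj.
- by apply: (pick 1 isT); apply: pairE; left; split; apply/val_inj.
- by apply: (pick 2 isT); apply: pairE; left; split; apply/val_inj.
- by apply: (pick 0 isT); apply: pairE; right; split; apply/val_inj.
- by apply: (pick 3 isT); apply: pairE; left; split; apply/val_inj.
- by apply: (pick 4 isT); apply: pairE; left; split; apply/val_inj.
- by apply: (pick 1 isT); apply: pairE; right; split; apply/val_inj.
- by apply: (pick 3 isT); apply: pairE; right; split; apply/val_inj.
- by apply: (pick 5 isT); apply: pairE; left; split; apply/val_inj.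
- by apply: (pick 2 isT); apply: pairE; right; split; apply/val_inj.
- by apply: (pick 4 isT); apply: pairE; right; split; apply/val_inj.
- by apply: (pick 5 isT); apply: pairE; right; split; apply/val_inj.
Qed.

Lemma coordinate_pair_card j : #|coordinate_pair j| = 2%N.
Proof.
by case: j => [[|[|[|[|[|[|//]]]]]] ltj]; rewrite /coordinate_pair /= cards2.
Qed.

Lemma coordinate_pair_inj : injective coordinate_pair.
Proof.
move=> i j /finset.setP eq_ij; apply/val_inj.
case: i j eq_ij => [[|[|[|[|[|[|//]]]]]] lti] [[|[|[|[|[|[|//]]]]]] ltj]
  eq_ij //;
by have := eq_ij 0; have := eq_ij 1; have := eq_ij 2; have := eq_ij 3;
  rewrite /coordinate_pair /= !inE.
Qed.

(** If v lies on the line and v_i = v_j = 0, the incidence relations reduce to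
    p_ij v_k = 0.  Conversely, when p_ij = 0, the columns i and j of the matrix
    of p are points of the line on which the coordinates i and j vanish; if
    both columns are zero, then every column has this property. *)
Lemma lines_meet_coordinate (p : 'rV[K]_6) (j : 'I_6) :
    p != 0 -> plucker_relation p = 0 ->
  lines_meet (line_of p) (coordinate_line (coordinate_pair j)) <-> p 0 j = 0.
Proof.
have pair_line (i1 i2 : 'I_4) (v : 'cV[K]_4) :
    coordinate_line [set i1; i2]%SET v <-> v i1 0 = 0 /\ v i2 0 = 0.
  split=> [vS|[v1 v2] i]; first by split; apply: vS; rewrite !inE eqxx ?orbT.
  by rewrite !inE => /orP[]/eqP->.
rewrite (plucker_vecE p); move: (p 0 0) (p 0 1) (p 0 2) (p 0 3) (p 0 4) (p 0 5).
move=> p01 p02 p03 p12 p13 p23 nzp plu.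
have meetE (S : {set 'I_4}) :
    lines_meet (line_of (plucker_vec p01 p02 p03 p12 p13 p23))
               (coordinate_line S) <->
    exists x y z w, [/\ [|| x != 0, y != 0, z != 0 | w != 0],
      coordinate_line S (point_vec x y z w) &
      [/\ p01 * z - p02 * y + p12 * x = 0, p01 * w - p03 * y + p13 * x = 0,
          p02 * w - p03 * z + p23 * x = 0 & p12 * w - p13 * z + p23 * y = 0]].
  split=> [[v]|[x [y [z [w [nzv Sv inc]]]]]].
    rewrite (point_vecE v) point_vec_neq0.
    case=> nzv /(line_of_incidence _ _ _ _ nzp plu) inc Sv.
    by exists (v 0 0), (v 1 0), (v 2 0), (v 3 0).
  exists (point_vec x y z w); rewrite point_vec_neq0; split=> //.
  exact/(line_of_incidence _ _ _ _ nzp plu).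
have col (S : {set 'I_4}) u0 u1 u2 u3 x y z w :
    p01 * u1 + p02 * u2 + p03 * u3 = x ->
    - p01 * u0 + p12 * u2 + p13 * u3 = y ->
    - p02 * u0 - p12 * u1 + p23 * u3 = z ->
    - p03 * u0 - p13 * u1 - p23 * u2 = w ->
    [|| x != 0, y != 0, z != 0 | w != 0] ->
    coordinate_line S (point_vec x y z w) ->
    lines_meet (line_of (plucker_vec p01 p02 p03 p12 p13 p23))
               (coordinate_line S).
  move=> xE yE zE wE nzv Sv; exists (point_vec x y z w).
  rewrite point_vec_neq0; split=> //.
  by exists (point_vec u0 u1 u2 u3); rewrite plucker_mxE xE yE zE wE.
have two_zero (q z w : K) : (z != 0) || (w != 0) -> q * z = 0 -> q * w = 0 ->
    q = 0.
  by case/orP => nz /eqP + /eqP; rewrite !mulf_eq0 (negPf nz) orbF => /eqP // _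
    /eqP.
move: nzp; rewrite plucker_vec_neq0 => nzp {plu}.
have nz1 := oner_neq0 K.
case: j => [[|[|[|[|[|[|//]]]]]] ltj]; rewrite /coordinate_pair /= mxE /=;
  (split=> [/meetE[x [y [z [w [nzv /pair_line[]]]]]]|pij0];
   rewrite ?point_vec_coord).
- move=> x0 y0 [e012 e013 e023 e123]; move: nzv e012 e013.
  rewrite x0 y0 eqxx ?orbF /= => nz e1 e2; apply: (two_zero _ _ _ nz).
    by apply: (eq_comb1 (k1 := 1) e1); ring.
  by apply: (eq_comb1 (k1 := 1) e2); ring.
- have [nz | ] := boolP ((p02 != 0) || (p03 != 0)).
    apply: (col _ 1 0 0 0 0 0 (- p02) (- p03)); rewrite ?pij0; try by ring.
      by rewrite ?oppr_eq0 eqxx /= ?orbF.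
    by apply/pair_line; rewrite !point_vec_coord.
  rewrite negb_or !negbK => /andP[/eqP p02_0 /eqP p03_0].
  have [nz | ] := boolP ((p12 != 0) || (p13 != 0)).
    apply: (col _ 0 1 0 0 0 0 (- p12) (- p13)); rewrite ?pij0; try by ring.
      by rewrite ?oppr_eq0 eqxx /= ?orbF.
    by apply/pair_line; rewrite !point_vec_coord.
  rewrite negb_or !negbK => /andP[/eqP p12_0 /eqP p13_0].
  rewrite pij0 p02_0 p03_0 p12_0 p13_0 eqxx /= ?orbF in nzp.
  apply: (col _ 0 0 1 0 0 0 0 (- p23)); rewrite ?p02_0 ?p12_0; try by ring.
    by rewrite ?oppr_eq0 nzp ?orbT.
  by apply/pair_line; rewrite !point_vec_coord.
- move=> x0 z0 [e012 e013 e023 e123]; move: nzv e012 e023.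
  rewrite x0 z0 eqxx ?orbF /= => nz e1 e2; apply: (two_zero _ _ _ nz).
    by apply: (eq_comb1 (k1 := -1) e1); ring.
  by apply: (eq_comb1 (k1 := 1) e2); ring.
- have [nz | ] := boolP ((p01 != 0) || (p03 != 0)).
    apply: (col _ 1 0 0 0 0 (- p01) 0 (- p03)); rewrite ?pij0; try by ring.
      by rewrite ?oppr_eq0 eqxx /= ?orbF.
    by apply/pair_line; rewrite !point_vec_coord.
  rewrite negb_or !negbK => /andP[/eqP p01_0 /eqP p03_0].
  have [nz | ] := boolP ((p12 != 0) || (p23 != 0)).
    apply: (col _ 0 0 1 0 0 p12 0 (- p23)); rewrite ?pij0; try by ring.
      by rewrite ?oppr_eq0 eqxx /= ?orbF.
    by apply/pair_line; rewrite !point_vec_coord.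
  rewrite negb_or !negbK => /andP[/eqP p12_0 /eqP p23_0].
  rewrite pij0 p01_0 p03_0 p12_0 p23_0 eqxx /= ?orbF in nzp.
  apply: (col _ 0 1 0 0 0 0 0 (- p13)); rewrite ?p01_0 ?p12_0; try by ring.
    by rewrite ?oppr_eq0 nzp ?orbT.
  by apply/pair_line; rewrite !point_vec_coord.
- move=> x0 w0 [e012 e013 e023 e123]; move: nzv e013 e023.
  rewrite x0 w0 eqxx ?orbF /= => nz e1 e2; apply: (two_zero _ _ _ nz).
    by apply: (eq_comb1 (k1 := -1) e1); ring.
  by apply: (eq_comb1 (k1 := -1) e2); ring.
- have [nz | ] := boolP ((p01 != 0) || (p02 != 0)).
    apply: (col _ 1 0 0 0 0 (- p01) (- p02) 0); rewrite ?pij0; try by ring.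
      by rewrite ?oppr_eq0 eqxx /= ?orbF.
    by apply/pair_line; rewrite !point_vec_coord.
  rewrite negb_or !negbK => /andP[/eqP p01_0 /eqP p02_0].
  have [nz | ] := boolP ((p13 != 0) || (p23 != 0)).
    apply: (col _ 0 0 0 1 0 p13 p23 0); rewrite ?pij0; try by ring.
      by rewrite ?oppr_eq0 eqxx /= ?orbF.
    by apply/pair_line; rewrite !point_vec_coord.
  rewrite negb_or !negbK => /andP[/eqP p13_0 /eqP p23_0].
  rewrite pij0 p01_0 p02_0 p13_0 p23_0 eqxx /= ?orbF in nzp.
  apply: (col _ 0 1 0 0 0 0 (- p12) 0); rewrite ?p01_0 ?p13_0; try by ring.
    by rewrite ?oppr_eq0 nzp ?orbT.
  by apply/pair_line; rewrite !point_vec_coord.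
- move=> y0 z0 [e012 e013 e023 e123]; move: nzv e012 e123.
  rewrite y0 z0 eqxx ?orbF /= => nz e1 e2; apply: (two_zero _ _ _ nz).
    by apply: (eq_comb1 (k1 := 1) e1); ring.
  by apply: (eq_comb1 (k1 := 1) e2); ring.
- have [nz | ] := boolP ((p01 != 0) || (p13 != 0)).
    apply: (col _ 0 1 0 0 p01 0 0 (- p13)); rewrite ?pij0; try by ring.
      by rewrite ?oppr_eq0 eqxx /= ?orbF.
    by apply/pair_line; rewrite !point_vec_coord.
  rewrite negb_or !negbK => /andP[/eqP p01_0 /eqP p13_0].
  have [nz | ] := boolP ((p02 != 0) || (p23 != 0)).
    apply: (col _ 0 0 1 0 p02 0 0 (- p23)); rewrite ?pij0; try by ring.
      by rewrite ?oppr_eq0 eqxx /= ?orbF.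
    by apply/pair_line; rewrite !point_vec_coord.
  rewrite negb_or !negbK => /andP[/eqP p02_0 /eqP p23_0].
  rewrite pij0 p01_0 p13_0 p02_0 p23_0 eqxx /= ?orbF in nzp.
  apply: (col _ 1 0 0 0 0 0 0 (- p03)); rewrite ?p01_0 ?p02_0; try by ring.
    by rewrite ?oppr_eq0 nzp ?orbT.
  by apply/pair_line; rewrite !point_vec_coord.
- move=> y0 w0 [e012 e013 e023 e123]; move: nzv e013 e123.
  rewrite y0 w0 eqxx ?orbF /= => nz e1 e2; apply: (two_zero _ _ _ nz).
    by apply: (eq_comb1 (k1 := 1) e1); ring.
  by apply: (eq_comb1 (k1 := -1) e2); ring.
- have [nz | ] := boolP ((p01 != 0) || (p12 != 0)).
    apply: (col _ 0 1 0 0 p01 0 (- p12) 0); rewrite ?pij0; try by ring.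
      by rewrite ?oppr_eq0 eqxx /= ?orbF.
    by apply/pair_line; rewrite !point_vec_coord.
  rewrite negb_or !negbK => /andP[/eqP p01_0 /eqP p12_0].
  have [nz | ] := boolP ((p03 != 0) || (p23 != 0)).
    apply: (col _ 0 0 0 1 p03 0 p23 0); rewrite ?pij0; try by ring.
      by rewrite ?oppr_eq0 eqxx /= ?orbF.
    by apply/pair_line; rewrite !point_vec_coord.
  rewrite negb_or !negbK => /andP[/eqP p03_0 /eqP p23_0].
  rewrite pij0 p01_0 p12_0 p03_0 p23_0 eqxx /= ?orbF in nzp.
  apply: (col _ 1 0 0 0 0 0 (- p02) 0); rewrite ?p01_0 ?p03_0; try by ring.
    by rewrite ?oppr_eq0 nzp ?orbT.
  by apply/pair_line; rewrite !point_vec_coord.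
- move=> z0 w0 [e012 e013 e023 e123]; move: nzv e023 e123.
  rewrite z0 w0 eqxx ?orbF /= => nz e1 e2; apply: (two_zero _ _ _ nz).
    by apply: (eq_comb1 (k1 := 1) e1); ring.
  by apply: (eq_comb1 (k1 := 1) e2); ring.
- have [nz | ] := boolP ((p02 != 0) || (p12 != 0)).
    apply: (col _ 0 0 1 0 p02 p12 0 0); rewrite ?pij0; try by ring.
      by rewrite ?oppr_eq0 eqxx /= ?orbF.
    by apply/pair_line; rewrite !point_vec_coord.
  rewrite negb_or !negbK => /andP[/eqP p02_0 /eqP p12_0].
  have [nz | ] := boolP ((p03 != 0) || (p13 != 0)).
    apply: (col _ 0 0 0 1 p03 p13 0 0); rewrite ?pij0; try by ring.
      by rewrite ?oppr_eq0 eqxx /= ?orbF.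
    by apply/pair_line; rewrite !point_vec_coord.
  rewrite negb_or !negbK => /andP[/eqP p03_0 /eqP p13_0].
  rewrite pij0 p02_0 p12_0 p03_0 p13_0 eqxx /= ?orbF in nzp.
  apply: (col _ 1 0 0 0 0 (- p01) 0 0); rewrite ?p02_0 ?p03_0; try by ring.
    by rewrite ?oppr_eq0 nzp ?orbT.
  by apply/pair_line; rewrite !point_vec_coord.
Qed.

End Lines.

(** * Equations of the families and genericity *)

Section Equations.
Variable R : comNzRingType.
Implicit Types (p : 'rV[R]_6) (t : 'rV[R]_8).

(** Polynomials that vanish on the family and suffice to determine its fibre
    over a generic octanomial; they need not generate the prime. *)
Definition family_equations ty p t : seq R :=
  let: (p01, p02, p03) := (p 0 0, p 0 1, p 0 2) in
  let: (p12, p13, p23) := (p 0 3, p 0 4, p 0 5) in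
  let: (a, b, c, d) := (t 0 0, t 0 1, t 0 2, t 0 3) in
  let: (e, f, g, h) := (t 0 4, t 0 5, t 0 6, t 0 7) in
  match ty with
  | CoordType => [:: p01; p02; p03; p12; p23]
  | PlaneType =>
    [:: p01; p02; p03; d * p13 + g * p23; h * p23 - d * p12]
  | DisjointType =>
    [:: p01 * (f * h - b * d) - p02 * (b * g - a * h);
        p03 * (f * h - b * d) - p02 * (a * d - f * g);
        p12 * (f * h - b * d) - p02 * (b * c - e * h);
        p13 * (f * h - b * d) - p02 * (e * g - a * c);
        p23 * (f * h - b * d) - p02 * (c * f - d * e)]
  | TwoType =>
    [:: p02; p13; p01 * p23 - p02 * p13 + p03 * p12;
        e * p01 ^+ 2 - a * p01 * p12 + c * p01 * p23 - g * p12 * p23;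
        e * p01 * p03 + a * p01 * p23 + c * p03 * p23 + g * p23 ^+ 2;
        f * p01 ^+ 2 + b * p01 * p03 + d * p01 * p23 + h * p03 * p23;
        (e * d - c * f) * p01 + (e * h - b * c) * p03 +
        (f * g - a * d) * p12 + (a * h - b * g) * p23]
  | OneType =>
    [:: p02; p01 * p23 - p02 * p13 + p03 * p12;
        e * p03 + f * p13 + a * p23; c * p01 - g * p12 - h * p13;
        (f * p01 + b * p03) * p01 + (h * p23 - d * p12) * p03;
        (f * p01 + b * p03) * p12 - (h * p23 - d * p12) * p23]
  end.

Lemma family_equations_vanish ty s i :
  (family_equations ty (family_p ty s) (family_t ty s))`_i = 0.
Proof.
case: ty; rewrite /family_equations /family_p /family_t;
  rewrite !plucker_vec_coord ?coef_vec_coord;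
  move: (s 0 0) (s 0 1) (s 0 2) (s 0 3) (s 0 4) (s 0 5) (s 0 6) (s 0 7) (s 0 8);
  move=> k0 k1 k2 k3 k4 k5 k6 k7 k8;
  by case: i => [|[|[|[|[|[|[|i]]]]]]] /=; rewrite ?nth_nil //; ring.
Qed.

Definition discriminant (c3 c2 c1 c0 : R) :=
  c2 ^+ 2 * c1 ^+ 2 - 4 * c3 * c1 ^+ 3 - 4 * c2 ^+ 3 * c0
  - 27 * c3 ^+ 2 * c0 ^+ 2 + 18 * c3 * c2 * c1 * c0.

(** The discriminant of the cubic in x
    e x (d + h x) ^ 2 - (f + b x) (a + c x) (d + h x) + g (f + b x) ^ 2,
    whose roots are the ratios p03 / p01 in the fibre; see
    [two_meeting_fiber]. *)
Definition two_meeting_discriminant (a b c d e f g h : R) :=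
  discriminant (h * (e * h - b * c))
    (2 * d * e * h - f * c * h - a * b * h - b * c * d + b ^+ 2 * g)
    (d ^+ 2 * e - a * f * h - c * d * f - a * b * d + 2 * b * f * g)
    (f * (f * g - a * d)).

(** The discriminant of the cubic in x
    x (d + h x) (h e x + f c) - (h a x + f g) (f + b x),
    whose roots are the ratios p03 / p01 in the fibre; see
    [one_meeting_fiber]. *)
Definition one_meeting_discriminant (a b c d e f g h : R) :=
  discriminant (e * h ^+ 2) (d * e * h - a * b * h + c * f * h)
    (c * d * f - a * f * h - b * f * g) (- f ^+ 2 * g).

Definition genericity t : R :=
  let: (a, b, c, d) := (t 0 0, t 0 1, t 0 2, t 0 3) in
  let: (e, f, g, h) := (t 0 4, t 0 5, t 0 6, t 0 7) in
  a * b * c * d * (e * f * g * h) *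
  ((b * g - a * h) * (f * h - b * d) * (a * d - f * g) *
   ((b * c - e * h) * (e * g - a * c) * (c * f - d * e))) *
  (two_meeting_discriminant a b c d e f g h *
   one_meeting_discriminant a b c d e f g h).

(** [genericity] is what the models need; the other components need it after
    a symmetry. *)
Definition total_genericity t : R :=
  \prod_(s : bool * bool * bool) genericity (unact_t s t).

End Equations.

Section EquationsMap.
Variables (R S : comNzRingType) (f : {rmorphism R -> S}).

Lemma map_family_equations ty p t i :
  f (family_equations ty p t)`_i =
  (family_equations ty (map_mx f p) (map_mx f t))`_i.
Proof.
rewrite /family_equations !mxE.
by case: ty; case: i => [|[|[|[|[|[|[|i]]]]]]] /=; rewrite ?nth_nil
  ?(rmorphD, rmorphB, rmorphM, rmorphN, rmorphXn, rmorph0).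
Qed.

Lemma map_discriminant c3 c2 c1 c0 :
  f (discriminant c3 c2 c1 c0) = discriminant (f c3) (f c2) (f c1) (f c0).
Proof.
rewrite /discriminant.
by rewrite !(rmorph_nat, rmorphXn, rmorphB, rmorphD, rmorphM).
Qed.

Lemma map_two_meeting_discriminant a b c d e f0 g h :
  f (two_meeting_discriminant a b c d e f0 g h) =
  two_meeting_discriminant (f a) (f b) (f c) (f d) (f e) (f f0) (f g) (f h).
Proof.
rewrite /two_meeting_discriminant map_discriminant.
by rewrite !(rmorph_nat, rmorphXn, rmorphB, rmorphD, rmorphM).
Qed.

Lemma map_one_meeting_discriminant a b c d e f0 g h :
  f (one_meeting_discriminant a b c d e f0 g h) =
  one_meeting_discriminant (f a) (f b) (f c) (f d) (f e) (f f0) (f g) (f h).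
Proof.
rewrite /one_meeting_discriminant map_discriminant.
by rewrite !(rmorphXn, rmorphB, rmorphD, rmorphM, rmorphN).
Qed.

Lemma map_genericity t : f (genericity t) = genericity (map_mx f t).
Proof.
rewrite (coef_vecE t) map_coef_vec /genericity !coef_vec_coord.
rewrite !rmorphM map_two_meeting_discriminant map_one_meeting_discriminant.
by rewrite !rmorphB !rmorphM.
Qed.

Lemma map_total_genericity t :
  f (total_genericity t) = total_genericity (map_mx f t).
Proof.
rewrite /total_genericity rmorph_prod; apply: eq_bigr => s _.
by rewrite map_genericity map_unact_t.
Qed.

End EquationsMap.

(** An explicit octanomial that satisfies all the genericity conditions. *)
Lemma total_genericity_nonzero :
  total_genericity (coef_vec 1 1 1 1 1 2 2 3 : 'rV[int]_8) != 0.
Proof.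
apply/prodf_neq0 => -[[[] []] []] _ /=;
  rewrite /swap_xy_t /swap_zw_t /swap_pairs_t ?coef_vec_coord;
  by rewrite /genericity !coef_vec_coord.
Qed.

Section Cubic.
Variable C : numClosedFieldType.

(** The discriminant is c3 ^ 4 times the square of the product of the
    differences of the roots. *)
Lemma cubic_roots (c3 c2 c1 c0 : C) :
    c3 != 0 -> discriminant c3 c2 c1 c0 != 0 ->
  exists r : seq C, [/\ size r = 3%N, uniq r &
    forall x, (c3 * x ^+ 3 + c2 * x ^+ 2 + c1 * x + c0 == 0) = (x \in r)].
Proof.
move=> c3_nz disc_nz; pose p := Poly [:: c0; c1; c2; c3].
have pE : p = [:: c0; c1; c2; c3] :> seq C by rewrite (@PolyK _ 0).
have sz_p : size p = 4%N by rewrite pE.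
have [r pr] := closed_field_poly_normal p.
rewrite lead_coefE sz_p pE /= in pr.
have sz_r : size r = 3%N.
  by have := sz_p; rewrite pr size_scale // size_prod_XsubC => -[].
move: r sz_r pr => [|r1 [|r2 [|r3 []]]] //= _.
rewrite !big_cons big_nil mulr1 => pr.
have rootsE x : c3 * x ^+ 3 + c2 * x ^+ 2 + c1 * x + c0 =
    c3 * ((x - r1) * ((x - r2) * (x - r3))).
  have -> : c3 * x ^+ 3 + c2 * x ^+ 2 + c1 * x + c0 = p.[x].
    by rewrite /horner pE /=; ring.
  by rewrite pr !hornerE.
have root0 x : c3 * x ^+ 3 + c2 * x ^+ 2 + c1 * x + c0 -
    c3 * ((x - r1) * ((x - r2) * (x - r3))) = 0 by rewrite rootsE subrr.
have c0E : c0 = - c3 * (r1 * r2 * r3).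
  by apply: (eq_comb1 (k1 := 1) (root0 0)); ring.
have nz2 : (2 : C) != 0 by rewrite pnatr_eq0.
have c1E : c1 = c3 * (r1 * r2 + r1 * r3 + r2 * r3).
  apply/subr0_eq; apply: (mulf0_r nz2).
  by apply: (eq_comb2 (k1 := 1) (k2 := -1) (root0 1) (root0 (-1))); ring.
have c2E : c2 = - c3 * (r1 + r2 + r3).
  apply/subr0_eq; apply: (mulf0_r nz2).
  apply: (eq_comb3 (k1 := 1) (k2 := 1) (k3 := -2)
            (root0 1) (root0 (-1)) (root0 0)); ring.
exists [:: r1; r2; r3]; split=> // [|x].
  have : discriminant c3 c2 c1 c0 =
      c3 ^+ 4 * ((r1 - r2) * (r1 - r3) * (r2 - r3)) ^+ 2.
    by rewrite /discriminant c2E c1E c0E; ring.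
  move=> discE; move: disc_nz; rewrite discE mulf_eq0 expf_eq0 /= => /norP[_].
  rewrite expf_eq0 /= !mulf_eq0 !subr_eq0 !negb_or => /andP[/andP[n12 n13] n23].
  by rewrite n12 n13 n23.
by rewrite rootsE !inE !mulf_eq0 (negPf c3_nz) /= !subr_eq0.
Qed.

End Cubic.

(** * Fibres of the families *)

Section SameLine.
Variable K : fieldType.

Lemma same_lineP (p q : 'rV[K]_6) :
  p != 0 -> reflect (exists k, p = k *: q) (p == q)%MS.
Proof.
move=> nzp; apply: (iffP andP) => [[/sub_rVP //]|[k pE]].
have nzk : k != 0 by apply: contraNneq nzp => k0; rewrite pE k0 scale0r.
split; apply/sub_rVP; first by exists k.
by exists k^-1; rewrite pE scalerA mulVf ?scale1r.
Qed.

(** The complement of the set of coordinate lines that the line meets. *)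
Definition support_of (p : 'rV[K]_6) : seq bool :=
  [:: p 0 0 != 0; p 0 1 != 0; p 0 2 != 0; p 0 3 != 0; p 0 4 != 0; p 0 5 != 0].

Lemma support_same_line (p q : 'rV[K]_6) :
  p != 0 -> (p == q)%MS -> support_of p = support_of q.
Proof.
move=> nzp /(same_lineP _ nzp) [k pE].
have nzk : k != 0 by apply: contraNneq nzp => k0; rewrite pE k0 scale0r.
by rewrite pE /support_of !mxE !mulf_eq0 (negPf nzk).
Qed.

End SameLine.

Definition family_support ty : seq bool :=
  match ty with
  | CoordType => [:: false; false; false; false; true; false]
  | PlaneType => [:: false; false; false; true; true; true]
  | DisjointType => [:: true; true; true; true; true; true]
  | TwoType => [:: true; false; true; true; false; true]
  | OneType => [:: true; false; true; true; true; true]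
  end.

Definition type_degree ty : nat :=
  match ty with TwoType | OneType => 3 | _ => 1 end.

Section FamilyFibers.
Variable C : numClosedFieldType.

(** The two inclusions are stated differently: a listed point must lie in the
    image of the parametrisation, while a point is only assumed to satisfy the
    equations in order to be listed.  These are the smallest and the largest
    candidate for the fibre of the component. *)
Definition is_fiber ty (t : 'rV[C]_8) (S : seq 'rV[C]_6) : Prop :=
  [/\ size S = type_degree ty,
      pairwise (fun p q => ~~ (p == q)%MS) S,
      {in S, forall p, [/\ p != 0, support_of p = family_support ty &
                           in_family ty p t]} &
      forall p, p != 0 -> (forall i, (family_equations ty p t)`_i = 0) ->
        has (fun q => (p == q)%MS) S].

Lemma is_fiber_single ty t q :
    type_degree ty = 1%N -> support_of q = family_support ty ->
    in_family ty q t ->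
    (forall p, (forall i, (family_equations ty p t)`_i = 0) ->
       exists k, p = k *: q) ->
  is_fiber ty t [:: q].
Proof.
move=> deg1 supp fam all_q; split=> //.
  move=> p; rewrite inE => /eqP ->; split=> //.
  apply: contra_eqN supp => /eqP ->; rewrite /support_of !mxE eqxx.
  by case: ty {deg1 fam all_q}.
by move=> p nzp /all_q pq; rewrite /= orbF; apply/same_lineP.
Qed.

Variables a b c d e f g h : C.
Let t := coef_vec a b c d e f g h.
Hypothesis generic_t : genericity t != 0.

Lemma generic_factors :
  [/\ [/\ a != 0, b != 0, c != 0 & d != 0],
      [/\ e != 0, f != 0, g != 0 & h != 0],
      [/\ b * g - a * h != 0, f * h - b * d != 0 & a * d - f * g != 0],
      [/\ b * c - e * h != 0, e * g - a * c != 0 & c * f - d * e != 0] &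
      two_meeting_discriminant a b c d e f g h != 0 /\
      one_meeting_discriminant a b c d e f g h != 0].
Proof.
move: generic_t; rewrite /genericity !coef_vec_coord !mulf_eq0 !negb_or.
case/andP=> /andP[]; case/andP=> /andP[/andP[/andP[? ?] ?] ?].
case/andP=> /andP[/andP[? ?] ?] ?.
by case/andP=> /andP[/andP[? ?] ?] /andP[/andP[? ?] ?] /andP[? ?]; split.
Qed.

Lemma coord_fiber : exists S, is_fiber CoordType t S.
Proof.
exists [:: plucker_vec 0 0 0 0 1 0]; apply: is_fiber_single => //.
- by rewrite /support_of !plucker_vec_coord eqxx oner_eq0.
- exact: in_family_coord.
move=> p eqs; exists (p 0 4); rewrite [p in LHS]plucker_vecE.
have := (eqs 0%N, eqs 1%N, eqs 2%N, eqs 3%N, eqs 4%N).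
rewrite /family_equations /= => -[[[[-> ->] ->] ->] ->].
by rewrite [RHS]plucker_vecE !mxE /= mulr1 mulr0.
Qed.

Lemma scale_plucker_vec (k p01 p02 p03 p12 p13 p23 : C) :
  k *: plucker_vec p01 p02 p03 p12 p13 p23 =
  plucker_vec (k * p01) (k * p02) (k * p03) (k * p12) (k * p13) (k * p23).
Proof. by rewrite [LHS]plucker_vecE !mxE. Qed.

Lemma plane_fiber : exists S, is_fiber PlaneType t S.
Proof.
have [[_ _ _ nzd] [_ _ nzg nzh] _ _ _] := generic_factors.
exists [:: plucker_vec 0 0 0 h (- g) d]; apply: is_fiber_single => //.
- by rewrite /support_of !plucker_vec_coord eqxx oppr_eq0 nzd nzg nzh.
- exists (params_vec h (- g) d 1 a b c e f).
  by rewrite /family_p /family_t !params_vec_coord mulN1r opprK !mul1r.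
move=> p eqs; exists (p 0 5 / d); move: eqs; rewrite (plucker_vecE p).
move: (p 0 0) (p 0 1) (p 0 2) (p 0 3) (p 0 4) (p 0 5).
move=> p01 p02 p03 p12 p13 p23 eqs.
have := (eqs 0%N, eqs 1%N, eqs 2%N, eqs 3%N, eqs 4%N).
rewrite /family_equations !plucker_vec_coord !coef_vec_coord /=.
case=> -[[[-> ->] ->] eq1] eq2.
rewrite scale_plucker_vec !mulr0; congr plucker_vec.
- by apply: (eq_comb1 (k1 := - d^-1) eq2); field.
- by apply: (eq_comb1 (k1 := d^-1) eq1); field.
- by field.
Qed.

Lemma disjoint_equations p :
  (forall i, (family_equations DisjointType p t)`_i = 0) ->
  exists k, p = k *: disjoint_line t.
Proof.
have [_ _ [_ nz02 _] _ _] := generic_factors.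
move=> eqs; exists (p 0 1 / (f * h - b * d)); move: eqs.
rewrite disjoint_lineE (plucker_vecE p).
move: (p 0 0) (p 0 1) (p 0 2) (p 0 3) (p 0 4) (p 0 5).
move=> p01 p02 p03 p12 p13 p23 eqs.
have := (eqs 0%N, eqs 1%N, eqs 2%N, eqs 3%N, eqs 4%N).
rewrite /family_equations !plucker_vec_coord !coef_vec_coord /=.
case=> -[[[eq0 eq1] eq2] eq3] eq4; rewrite scale_plucker_vec.
congr plucker_vec; last 1 first.
- by apply: (eq_comb1 (k1 := (f * h - b * d)^-1) eq4); field.
- by apply: (eq_comb1 (k1 := (f * h - b * d)^-1) eq0); field.
- by field.
- by apply: (eq_comb1 (k1 := (f * h - b * d)^-1) eq1); field.
- by apply: (eq_comb1 (k1 := (f * h - b * d)^-1) eq2); field.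
- by apply: (eq_comb1 (k1 := (f * h - b * d)^-1) eq3); field.
Qed.

Lemma disjoint_line_support :
  support_of (disjoint_line t) = [:: true; true; true; true; true; true].
Proof.
have [_ _ [nz01 nz02 nz03] [nz12 nz13 nz23] _] := generic_factors.
rewrite disjoint_lineE /support_of !plucker_vec_coord.
by rewrite nz01 nz02 nz03 nz12 nz13 nz23.
Qed.

Lemma disjoint_fiber : exists S, is_fiber DisjointType t S.
Proof.
have [_ _ [_ nz02 _] _ _] := generic_factors.
exists [:: disjoint_line t]; apply: is_fiber_single => //.
- exact: disjoint_line_support.
- exists (params_vec (f * h - b * d) ((b * c - e * h) / (f * h - b * d))
    ((b * g - a * h) / (f * h - b * d)) (- (c * f - d * e) / (f * h - b * d))
    ((a * d - f * g) / (f * h - b * d)) f b d h).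
  rewrite disjoint_lineE /family_p /family_t !params_vec_coord; split.
    by congr plucker_vec; field.
  by congr coef_vec; field.
exact: disjoint_equations.
Qed.

(** The fibre is the set of the lines pt x, for x a root of the cubic; the
    normalisation of pt makes lines of different roots different. *)
Lemma is_fiber_cubic ty (pt : C -> 'rV[C]_6) (c3 c2 c1 c0 : C) :
    type_degree ty = 3%N -> c3 != 0 -> discriminant c3 c2 c1 c0 != 0 ->
    (forall x, pt x 0 0 = 1 /\ pt x 0 2 = x) ->
    (forall x, c3 * x ^+ 3 + c2 * x ^+ 2 + c1 * x + c0 = 0 ->
       support_of (pt x) = family_support ty /\ in_family ty (pt x) t) ->
    (forall p, p != 0 -> (forall i, (family_equations ty p t)`_i = 0) ->
       exists k x, c3 * x ^+ 3 + c2 * x ^+ 2 + c1 * x + c0 = 0 /\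
         p = k *: pt x) ->
  exists S, is_fiber ty t S.
Proof.
move=> deg3 nz3 nzdisc norm_pt roots_pt all_pt.
have [r [sz_r uniq_r rootsE]] := cubic_roots nz3 nzdisc.
have nz_pt x : pt x != 0.
  apply/eqP => pt0; have [] := norm_pt x.
  by rewrite pt0 mxE => /esym/eqP; rewrite oner_eq0.
have pt_inj x y : (pt x == pt y)%MS -> x = y.
  move/(same_lineP _ (nz_pt x)) => [k /rowP pE].
  have [[x0 <-] [y0 <-]] := (norm_pt x, norm_pt y).
  have := pE 0; rewrite mxE x0 y0 mulr1 => k1.
  by rewrite pE mxE -k1 mul1r.
exists (map pt r); split; first by rewrite size_map sz_r deg3.
- rewrite pairwise_map; move: uniq_r; rewrite uniq_pairwise.
  by apply: sub_pairwise => x y /=; apply: contraNN => /pt_inj ->.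
- move=> p /mapP[x xr ->].
  by have [|supp fam] := roots_pt x; [apply/eqP; rewrite rootsE | split].
move=> p nzp /(all_pt _ nzp) [k [x [x_root pE]]].
apply/hasP; exists (pt x); last by apply/same_lineP => //; exists k.
by apply/map_f; rewrite -rootsE x_root eqxx.
Qed.

(** The line is z = be * x, w = x' * y, and l1 + be * x' * l2 vanishes on it.
    The two coefficients of this form give two equations; the one for y is
    linear in be, and eliminating be yields the cubic for x'. *)
Lemma two_meeting_fiber : exists S, is_fiber TwoType t S.
Proof.
have [_ [nze nzf nzg nzh] [_ nz02 nz03] [nz12 _ _] [nzdisc _]] :=
  generic_factors.
pose be x := - (f + b * x) / (x * (d + h * x)).
have common x : f + b * x = 0 -> d + h * x = 0 -> False.
  move=> V0 W0; move/eqP: nz02; apply.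
  by apply: (eq_comb2 (k1 := h) (k2 := - b) V0 W0); ring.
apply: (is_fiber_cubic (pt := fun x => plucker_vec 1 0 x (- be x) 0 (be x * x))
  _ _ nzdisc) => //.
- by rewrite mulf_neq0 // -oppr_eq0 opprB.
- by move=> x; rewrite !plucker_vec_coord.
- move=> x x_root.
  have rootE : e * x * (d + h * x) ^+ 2
      - (f + b * x) * (a + c * x) * (d + h * x) + g * (f + b * x) ^+ 2 = 0.
    by rewrite -[RHS]x_root; ring.
  have nzx : x != 0.
    apply/eqP => x0; have /eqP[] := mulf_neq0 nzf nz03.
    by apply: (eq_comb1 (k1 := -1) x_root); rewrite x0; ring.
  have nzW : d + h * x != 0.
    apply/eqP => W0; apply: (common x _ W0); apply/eqP.
    rewrite W0 expr0n mulr0 !mulr0 subr0 add0r in rootE.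
    by move/eqP: rootE; rewrite mulf_eq0 (negPf nzg) expf_eq0.
  have nzV : f + b * x != 0.
    apply/eqP => V0; apply: (common x V0); apply/eqP.
    rewrite V0 expr0n !mul0r mulr0 subr0 addr0 in rootE.
    have /eqP := mulf0_r (mulf_neq0 nze nzx) rootE.
    by rewrite sqrf_eq0.
  have nzbe : be x != 0.
    by rewrite mulf_neq0 ?oppr_eq0 // invr_neq0 // mulf_neq0.
  split.
    rewrite /support_of !plucker_vec_coord eqxx oner_eq0 oppr_eq0.
    by rewrite nzx nzbe (mulf_neq0 nzbe nzx).
  exists (params_vec 1 (be x) x a b c d g h).
  rewrite /family_p /family_t !params_vec_coord; split.
    by congr plucker_vec; ring.
  congr coef_vec; last by rewrite /be; field; apply/andP.
  apply: (eq_comb1 (k1 := (x * (d + h * x) ^+ 2)^-1) rootE).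
  by rewrite /be; field; apply/andP.
move=> p; rewrite (plucker_vecE p).
move: (p 0 0) (p 0 1) (p 0 2) (p 0 3) (p 0 4) (p 0 5).
move=> p01 p02 p03 p12 p13 p23 nzp eqs.
have := (eqs 0%N, eqs 1%N, eqs 2%N, eqs 3%N, eqs 4%N, eqs 5%N, eqs 6%N).
rewrite /family_equations !plucker_vec_coord !coef_vec_coord /=.
case=> -[[[[[p02_0 p13_0] plu] eq1] eq2] eq3] eq4 {eqs}.
rewrite {}p02_0 {}p13_0 mulr0 subr0 in nzp plu *.
have nz01 : p01 != 0.
  apply/eqP => p01_0; rewrite {}p01_0 in nzp plu eq1 eq2 eq3 eq4.
  have p03p23 : p03 * p23 = 0.
    by apply: (mulf0_r nzh); apply: (eq_comb1 (k1 := 1) eq3); ring.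
  have p23_0 : p23 = 0.
    apply/eqP; rewrite -sqrf_eq0; apply/eqP; apply: (mulf0_r nzg).
    by apply: (eq_comb2 (k1 := 1) (k2 := - c) eq2 p03p23); ring.
  have p03p12 : p03 * p12 = 0 by apply: (eq_comb1 (k1 := 1) plu); ring.
  have nz12' : e * h - b * c != 0 by rewrite -oppr_eq0 opprB.
  have nz03' : f * g - a * d != 0 by rewrite -oppr_eq0 opprB.
  have p03_0 : p03 = 0.
    apply/eqP; rewrite -sqrf_eq0; apply/eqP; apply: (mulf0_r nz12').
    apply: (eq_comb3 (k1 := p03) (k2 := - (f * g - a * d))
      (k3 := - (a * h - b * g)) eq4 p03p12 p03p23); ring.
  have p12_0 : p12 = 0.
    apply: (mulf0_r nz03').
    by apply: (eq_comb1 (k1 := 1) eq4); rewrite p23_0 p03_0; ring.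
  by move: nzp; rewrite p03_0 p12_0 p23_0 plucker_vec0 eqxx.
pose x := p03 / p01; pose bx := - p12 / p01.
have p03E : p03 = p01 * x by rewrite /x; field.
have p12E : p12 = - p01 * bx by rewrite /bx; field.
have p23E : p23 = p01 * (bx * x).
  by apply: (eq_comb1 (k1 := p01^-1) plu); rewrite /bx /x; field.
rewrite {}p03E {}p12E {}p23E in eq1 eq2 eq3 eq4 {plu} *.
move: x bx {nzp} eq1 eq2 eq3 eq4 => x bx eq1 _ eq3 _.
have {}eq1 : e + a * bx + c * bx * x + g * bx ^+ 2 * x = 0.
  by apply: (eq_comb1 (k1 := (p01 ^+ 2)^-1) eq1); field.
have {}eq3 : f + b * x + bx * (x * (d + h * x)) = 0.
  by apply: (eq_comb1 (k1 := (p01 ^+ 2)^-1) eq3); field.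
have nzx : x != 0.
  apply/eqP => x0; move/eqP: nzf; apply.
  by apply: (eq_comb1 (k1 := 1) eq3); rewrite x0; ring.
have nzW : d + h * x != 0.
  apply/eqP => W0; apply: (common x _ W0).
  by apply: (eq_comb1 (k1 := 1) eq3); rewrite W0; ring.
have bxE : bx = be x.
  apply: (eq_comb1 (k1 := (x * (d + h * x))^-1) eq3).
  by rewrite /be; field; apply/andP.
exists p01, x; split.
  apply: (eq_comb2 (k1 := x * (d + h * x) ^+ 2)
    (k2 := - (a + c * x) * (d + h * x)
           + g * (f + b * x - bx * (x * (d + h * x)))) eq1 eq3).
  by ring.
by rewrite scale_plucker_vec -bxE; congr plucker_vec; ring.
Qed.

(** Normalised by p01 = 1, the line is given by x' = p03, be = - p12 and
    ka = p13.  The equations are linear in ka and be one after the other, with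
    the same expression of be by x' as for lines meeting two coordinate
    lines; eliminating both yields the cubic for x'. *)
Lemma one_meeting_fiber : exists S, is_fiber OneType t S.
Proof.
have [_ [nze nzf nzg nzh] [_ nz02 nz03] [nz12 nz13 _] [_ nzdisc]] :=
  generic_factors.
have [[nza nzb nzc nzd] _ _ _ _] := generic_factors.
pose be x := - (f + b * x) / (x * (d + h * x)).
pose ka x := (c + g * be x) / h.
have common x : f + b * x = 0 -> d + h * x = 0 -> False.
  move=> V0 W0; move/eqP: nz02; apply.
  by apply: (eq_comb2 (k1 := h) (k2 := - b) V0 W0); ring.
apply: (is_fiber_cubic
  (pt := fun x => plucker_vec 1 0 x (- be x) (ka x) (be x * x))
  _ _ nzdisc) => //.
- by rewrite mulf_neq0 // expf_neq0.
- by move=> x; rewrite !plucker_vec_coord.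
- move=> x x_root.
  have rootE : x * (d + h * x) * (h * e * x + f * c)
      - (h * a * x + f * g) * (f + b * x) = 0.
    by rewrite -[RHS]x_root; ring.
  have nzx : x != 0.
    apply/eqP => x0; have /eqP[] := mulf_neq0 (expf_neq0 2 nzf) nzg.
    by apply: (eq_comb1 (k1 := -1) x_root); rewrite x0; ring.
  have nzW : d + h * x != 0.
    apply/eqP => W0; move/eqP: (nz03); apply.
    have hax : h * a * x + f * g = 0.
      have nzV : f + b * x != 0 by apply/eqP => V0; apply: (common x V0 W0).
      apply: (mulf0_r nzV).
      by apply: (eq_comb1 (k1 := -1) rootE); rewrite W0; ring.
    by apply: (eq_comb2 (k1 := -1) (k2 := a) hax W0); ring.
  have nzV : f + b * x != 0.
    apply/eqP => V0; have /eqP[] := mulf_neq0 nzf nz12.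
    have hex : h * e * x + f * c = 0.
      apply: (mulf0_r (mulf_neq0 nzx nzW)).
      by apply: (eq_comb1 (k1 := 1) rootE); rewrite V0; ring.
    by apply: (eq_comb2 (k1 := b) (k2 := - (h * e)) hex V0); ring.
  have nzbe : be x != 0.
    by rewrite mulf_neq0 ?oppr_eq0 // invr_neq0 // mulf_neq0.
  have eq1 : (e + a * be x) * x + f * ka x = 0.
    apply: (eq_comb1 (k1 := (h * (x * (d + h * x)))^-1) rootE).
    by rewrite /ka /be; field; apply/and3P.
  have eq2 : c + g * be x - h * ka x = 0 by rewrite /ka; field.
  have eq3 : f + b * x + be x * (x * (d + h * x)) = 0.
    by rewrite /be; field; apply/andP.
  have nzka : ka x != 0.
    apply/eqP => ka0; rewrite {}ka0 in eq1 eq2.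
    move/eqP: nz13; apply; rewrite !mulr0 addr0 subr0 in eq1 eq2.
    have eq1' : e + a * be x = 0.
      by apply: (mulf0_r nzx); rewrite mulrC.
    by apply: (eq_comb2 (k1 := g) (k2 := - a) eq1' eq2); ring.
  split.
    rewrite /support_of !plucker_vec_coord eqxx oner_eq0 oppr_eq0.
    by rewrite nzx nzbe nzka (mulf_neq0 nzbe nzx).
  exists (params_vec (be x) (- (d + h * x)) 1 x (ka x) a g (- f / x) h).
  rewrite /family_p /family_t !params_vec_coord; split.
    by congr plucker_vec; ring.
  congr coef_vec; try by field.
  + by apply: (eq_comb1 (k1 := x^-1) eq3); field.
  + by apply: (eq_comb1 (k1 := 1) eq2); ring.
  + by apply: (eq_comb1 (k1 := x^-1) eq1); field.
move=> p; rewrite (plucker_vecE p).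
move: (p 0 0) (p 0 1) (p 0 2) (p 0 3) (p 0 4) (p 0 5).
move=> p01 p02 p03 p12 p13 p23 nzp eqs.
have := (eqs 0%N, eqs 1%N, eqs 2%N, eqs 3%N, eqs 4%N, eqs 5%N).
rewrite /family_equations !plucker_vec_coord !coef_vec_coord /=.
case=> -[[[[p02_0 plu] eq1] eq2] eq3] eq4 {eqs}.
rewrite {}p02_0 mul0r subr0 in nzp plu *.
have nz01 : p01 != 0.
  apply/eqP => p01_0; rewrite {}p01_0 in nzp plu eq1 eq2 eq3 eq4.
  have p03p12 : p03 * p12 = 0 by apply: (eq_comb1 (k1 := 1) plu); ring.
  have [p03_0 | nzp03] := eqVneq p03 0; last first.
    have p12_0 := mulf0_r nzp03 p03p12.
    have p23_0 : p23 = 0.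
      apply: (mulf0_r (mulf_neq0 nzp03 nzh)).
      by apply: (eq_comb1 (k1 := 1) eq3); rewrite p12_0; ring.
    have p13_0 : p13 = 0.
      by apply: (mulf0_r nzh); apply: (eq_comb1 (k1 := -1) eq2);
        rewrite p12_0; ring.
    move/eqP: (mulf_neq0 nze nzp03); apply.
    by apply: (eq_comb1 (k1 := 1) eq1); rewrite p23_0 p13_0; ring.
  have [p23_0 | nzp23] := eqVneq p23 0.
    have p13_0 : p13 = 0.
      by apply: (mulf0_r nzf); apply: (eq_comb1 (k1 := 1) eq1);
        rewrite p23_0 p03_0; ring.
    have p12_0 : p12 = 0.
      by apply: (mulf0_r nzg); apply: (eq_comb1 (k1 := -1) eq2);
        rewrite p13_0; ring.
    by move: nzp; rewrite p03_0 p12_0 p13_0 p23_0 plucker_vec0 eqxx.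
  have hd : h * p23 - d * p12 = 0.
    apply: (mulf0_r nzp23).
    by apply: (eq_comb1 (k1 := -1) eq4); rewrite p03_0; ring.
  (* The linear relations eq1, eq2 and hd between p12, p13 and p23 have
     determinant h * (a * d - f * g) up to sign. *)
  move/eqP: (mulf_neq0 (mulf_neq0 nzh nz03) nzp23); apply.
  apply: (eq_comb3 (k1 := h * d) (k2 := f * d) (k3 := - f * g) eq1 eq2 hd).
  by rewrite p03_0; ring.
pose x := p03 / p01; pose bx := - p12 / p01; pose kx := p13 / p01.
have p03E : p03 = p01 * x by rewrite /x; field.
have p12E : p12 = - p01 * bx by rewrite /bx; field.
have p13E : p13 = p01 * kx by rewrite /kx; field.
have p23E : p23 = p01 * (bx * x).
  by apply: (eq_comb1 (k1 := p01^-1) plu); rewrite /bx /x; field.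
rewrite {}p03E {}p12E {}p13E {}p23E in eq1 eq2 eq3 {plu eq4} *.
move: x bx kx {nzp} eq1 eq2 eq3 => x bx kx eq1 eq2 eq3.
have {}eq1 : (e + a * bx) * x + f * kx = 0.
  by apply: (eq_comb1 (k1 := p01^-1) eq1); field.
have {}eq2 : c + g * bx - h * kx = 0.
  by apply: (eq_comb1 (k1 := p01^-1) eq2); field.
have {}eq3 : f + b * x + bx * (x * (d + h * x)) = 0.
  by apply: (eq_comb1 (k1 := (p01 ^+ 2)^-1) eq3); field.
have nzx : x != 0.
  apply/eqP => x0; move/eqP: nzf; apply.
  by apply: (eq_comb1 (k1 := 1) eq3); rewrite x0; ring.
have nzW : d + h * x != 0.
  apply/eqP => W0; apply: (common x _ W0).
  by apply: (eq_comb1 (k1 := 1) eq3); rewrite W0; ring.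
have bxE : bx = be x.
  apply: (eq_comb1 (k1 := (x * (d + h * x))^-1) eq3).
  by rewrite /be; field; apply/andP.
have kxE : kx = ka x.
  by rewrite /ka -bxE; apply: (eq_comb1 (k1 := - h^-1) eq2); field.
exists p01, x; split.
  apply: (eq_comb3 (k1 := h * x * (d + h * x)) (k2 := f * x * (d + h * x))
    (k3 := - (h * a * x + f * g)) eq1 eq2 eq3).
  by ring.
by rewrite scale_plucker_vec -kxE -bxE; congr plucker_vec; ring.
Qed.

End FamilyFibers.

(** * Fibres of the components *)

Section ComponentFibers.
Variable C : numClosedFieldType.
Implicit Types (t : 'rV[C]_8).

Lemma family_fiber ty t : genericity t != 0 -> exists S, is_fiber ty t S.
Proof.
rewrite (coef_vecE t) => gen_t; case: ty.
- exact: coord_fiber.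
- exact: plane_fiber.
- exact: disjoint_fiber.
- exact: two_meeting_fiber.
- exact: one_meeting_fiber.
Qed.

(** Symmetries permute the Plücker coordinates up to sign. *)
Definition swap_xy_support (s : seq bool) :=
  [seq nth false s i | i <- [:: 0; 3; 4; 1; 2; 5]%N].
Definition swap_zw_support (s : seq bool) :=
  [seq nth false s i | i <- [:: 0; 2; 1; 4; 3; 5]%N].
Definition swap_pairs_support (s : seq bool) :=
  [seq nth false s i | i <- [:: 5; 1; 3; 2; 4; 0]%N].

Definition act_support (s : bool * bool * bool) supp :=
  let: (i, j, k) := s in
  let supp := if k then swap_pairs_support supp else supp in
  let supp := if j then swap_zw_support supp else supp in
  if i then swap_xy_support supp else supp.

Lemma support_act_p s (p : 'rV[C]_6) :
  support_of (act_p s p) = act_support s (support_of p).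
Proof.
have xyS q :
    support_of (swap_xy_p q) = swap_xy_support (support_of q :> seq bool).
  by rewrite /support_of /swap_xy_p !plucker_vec_coord oppr_eq0.
have zwS q :
    support_of (swap_zw_p q) = swap_zw_support (support_of q :> seq bool).
  by rewrite /support_of /swap_zw_p !plucker_vec_coord oppr_eq0.
have prS q :
    support_of (swap_pairs_p q) = swap_pairs_support (support_of q :> seq bool).
  by rewrite /support_of /swap_pairs_p !plucker_vec_coord !oppr_eq0.
by case: s => [[[] []] []] /=; rewrite ?xyS ?zwS ?prS.
Qed.

Definition component_support k : seq bool :=
  act_support (component_sym k) (family_support (component_type k)).

(** The vanishing Plücker coordinates tell the fifteen components apart. *)
Lemma component_support_inj : injective component_support.
Proof.
move=> k l.
case: k => [[[|[|[|[|//]]]] i1]|[[|[|[|[|//]]]] i1]||[[|[|//]] i1]|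
  [[|[|[|[|//]]]] i1]];
case: l => [[[|[|[|[|//]]]] i2]|[[|[|[|[|//]]]] i2]||[[|[|//]] i2]|
  [[|[|[|[|//]]]] i2]] //= _;
by congr (_ _); apply/val_inj.
Qed.

Lemma fiberP (I : set ufv_ring) t p :
  fiber I t p <-> p != 0 /\ forall q, I q -> eval_at (@ratr C) p t q = 0.
Proof.
pose ev : {rmorphism ufv_ring -> C} :=
  (meval (fun i => row_mx p t 0 i) \o map_mpoly (@ratr C))%FUN.
have evE : eval_at (@ratr C) p t =1 ev.
  have evX i : ev 'X_i = row_mx p t 0 i by rewrite /= map_mpolyX mevalXU.
  apply: ufv_morphism_ext; rewrite ?eval_at_p ?eval_at_t.
    by apply/rowP => i; rewrite !mxE evX row_mxEl.
  by apply/rowP => i; rewrite !mxE evX row_mxEr.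
split=> -[nzp Ip]; split=> // q Iq; first by rewrite evE; exact: Ip.
by rewrite -[LHS]/(ev q) -evE Ip.
Qed.

Lemma fiber_sub (I J : set ufv_ring) t p :
  I `<=` J -> fiber J t p -> fiber I t p.
Proof. by move=> IJ [nzp Jp]; split=> // q /IJ; exact: Jp. Qed.

Lemma fiber_I_ufv_lies_on t p : fiber I_ufv t p -> lies_on p t.
Proof.
by case/fiberP => _ /I_ufv_lies_on; rewrite eval_at_p eval_at_t.
Qed.

Lemma fiber_component_I_ufv k t p :
  fiber (component_ideal k) t p -> fiber I_ufv t p.
Proof. by apply: fiber_sub; exact: I_ufv_sub_component. Qed.

Lemma in_component_fiber k t p :
  p != 0 -> in_component k p t -> fiber (component_ideal k) t p.
Proof.
move=> nzp in_k; apply/fiberP; split=> //.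
by apply: component_ideal_vanish; rewrite eval_at_p eval_at_t.
Qed.

Lemma fiber_I_ufv_component t p :
  fiber I_ufv t p -> exists k, fiber (component_ideal k) t p.
Proof.
move=> fib_p; have nz2 : (2 : C) != 0 by rewrite pnatr_eq0.
have [k in_k] := on_some_component nz2 (fiber_I_ufv_lies_on fib_p).
by exists k; apply: in_component_fiber => //; case: fib_p.
Qed.

(** The equations of the model, transported to the component and evaluated at
    the coordinate functions, are elements of the prime. *)
Lemma fiber_equations k t p : fiber (component_ideal k) t p ->
  forall i, (family_equations (component_type k)
    (unact_p (component_sym k) p) (unact_t (component_sym k) t))`_i = 0.
Proof.
case/fiberP => _ vanish i.
pose q := (family_equations (component_type k)
  (unact_p (component_sym k) p_vars) (unact_t (component_sym k) t_vars))`_i.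
have kq : component_ideal k q.
  rewrite /component_ideal /= map_family_equations map_unact_p map_unact_t.
  rewrite component_eval_p component_eval_t act_pK act_tK.
  exact: family_equations_vanish.
have := vanish q kq; rewrite map_family_equations map_unact_p map_unact_t.
by rewrite eval_at_p eval_at_t.
Qed.

Lemma genericity_unact s t :
  total_genericity t != 0 -> genericity (unact_t s t) != 0.
Proof. by move/prodf_neq0; apply. Qed.

Lemma component_fiber k t : total_genericity t != 0 ->
  exists S : seq 'rV[C]_6,
    [/\ size S = component_degree k,
        pairwise (fun p q => ~~ (p == q)%MS) S,
        {in S, forall p, fiber (component_ideal k) t p /\
                         support_of p = component_support k} &
        forall p, fiber (component_ideal k) t p ->
          has (fun q => (p == q)%MS) S].
Proof.
move=> /(genericity_unact (component_sym k)) /(family_fiber (component_type k)).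
set s := component_sym k => -[S [sz_S pair_S mem_S all_S]].
have same_act (p q : 'rV[C]_6) :
    p != 0 -> (act_p s p == act_p s q)%MS = (p == q)%MS.
  move=> nzp; apply/same_lineP/same_lineP => //; first exact: act_p_neq0.
    by case=> c /(congr1 (unact_p s)); rewrite unact_pZ !act_pK; exists c.
  by case=> c ->; exists c; rewrite act_pZ.
exists (map (act_p s) S); split.
- by rewrite size_map sz_S; case: (k).
- rewrite pairwise_map.
  apply: (@sub_in_pairwise _ (mem S)) pair_S; last by apply/allP.
  by move=> p q pS qS /=; rewrite same_act //; have [] := mem_S _ pS.
- move=> p /mapP[p' /mem_S [nzp' supp fam] ->].
  split; last by rewrite support_act_p supp.
  apply: in_component_fiber; first exact: act_p_neq0.
  by rewrite /in_component act_pK.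
move=> p fib_p; have [nzp _] := fib_p.
have := all_S _ (unact_p_neq0 s nzp) (fiber_equations fib_p).
case/hasP => q qS pq; apply/hasP; exists (act_p s q); first exact: map_f.
by rewrite -(unact_pK s p) same_act // unact_p_neq0.
Qed.

Lemma fiber_support k t p : total_genericity t != 0 ->
  fiber (component_ideal k) t p -> support_of p = component_support k.
Proof.
move=> gen_t fib_p; have [nzp _] := fib_p.
have [S [_ _ mem_S all_S]] := component_fiber k gen_t.
have /hasP[q qS pq] := all_S p fib_p.
by rewrite (support_same_line nzp pq); case: (mem_S q qS).
Qed.

Lemma nth_support (p : 'rV[C]_6) (j : 'I_6) :
  nth false (support_of p) j = (p 0 j != 0).
Proof.
case: j => [[|[|[|[|[|[|//]]]]]] ltj] /=; congr (p _ _ != 0); exact/val_inj.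
Qed.

Lemma fiber_meet k t p (j : 'I_6) : total_genericity t != 0 ->
  fiber (component_ideal k) t p ->
  lines_meet (line_of p) (coordinate_line (coordinate_pair j)) <->
  ~~ nth false (component_support k) j.
Proof.
move=> gen_t fib_p; have [nzp _] := fib_p.
have [plu _] := fiber_I_ufv_lies_on (fiber_component_I_ufv fib_p).
rewrite lines_meet_coordinate // -(fiber_support gen_t fib_p) nth_support negbK.
exact: rwP eqP.
Qed.

Lemma exists_generic : exists t, total_genericity t != 0.
Proof.
exists (map_mx intr (coef_vec 1 1 1 1 1 2 2 3 : 'rV[int]_8)).
by rewrite -map_total_genericity intr_eq0 total_genericity_nonzero.
Qed.

Lemma genericallyI (Phi : 'rV[C]_8 -> Prop) :
  (forall t, total_genericity t != 0 -> Phi t) -> generically Phi.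
Proof.
move=> PhiP; pose T : 'rV[{mpoly C[8]}]_8 := \row_i 'X_i.
have evT t : (total_genericity T).@[fun i => t 0 i] = total_genericity t.
  rewrite map_total_genericity; congr total_genericity.
  by apply/rowP => i; rewrite !mxE [LHS]mevalXU.
exists (total_genericity T) => [|t]; last by rewrite evT; exact: PhiP.
have [t0 gen_t0] := exists_generic.
by apply: contraNneq gen_t0 => T0; rewrite -evT T0 meval0.
Qed.

(** An inclusion of primes gives the opposite inclusion of fibres, and the
    fibres over a generic octanomial are nonempty with different supports. *)
Lemma component_ideal_sub k l :
  component_ideal k `<=` component_ideal l -> k = l.
Proof.
move=> sub_kl; have [t gen_t] := exists_generic.
have [S [sz_S _ mem_S _]] := component_fiber l gen_t.
have [p pS] : exists p, p \in S.
  case: S sz_S {mem_S} => [|p S _]; first by case: (l).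
  by exists p; rewrite mem_head.
have [fib_p supp_p] := mem_S p pS.
apply: component_support_inj; rewrite -supp_p.
by rewrite (fiber_support gen_t (fiber_sub sub_kl fib_p)).
Qed.

(** Every prime over the ideal contains one of finitely many incomparable
    primes over the ideal, which are therefore the minimal ones. *)
Lemma minimal_prime_component P :
  minimal_prime I_ufv P <-> exists k, P = component_ideal k.
Proof.
split=> [[prP IP minP]|[k ->]].
  have [k kP] := prime_over_I_ufv prP IP; exists k.
  by rewrite (minP _ (component_ideal_prime k) (@I_ufv_sub_component k) kP).
split; [exact: component_ideal_prime | exact: I_ufv_sub_component |].
move=> Q prQ IQ Qk; have [l lQ] := prime_over_I_ufv prQ IQ.
have lk : l = k by apply: component_ideal_sub => q /lQ /Qk.
by apply/seteqP; split; [exact: Qk | rewrite -lk; exact: lQ].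
Qed.

End ComponentFibers.

(** * Lines in coordinate planes *)

Section Incidence.
Variable C : numClosedFieldType.
Implicit Types (t : 'rV[C]_8) (p : 'rV[C]_6).

Lemma line_of_coords p (v : 'cV[C]_4) : p != 0 -> plucker_relation p = 0 ->
  line_of p v <->
  [/\ p 0 0 * v 2 0 - p 0 1 * v 1 0 + p 0 3 * v 0 0 = 0,
      p 0 0 * v 3 0 - p 0 2 * v 1 0 + p 0 4 * v 0 0 = 0,
      p 0 1 * v 3 0 - p 0 2 * v 2 0 + p 0 5 * v 0 0 = 0 &
      p 0 3 * v 3 0 - p 0 4 * v 2 0 + p 0 5 * v 1 0 = 0].
Proof.
rewrite (plucker_vecE p) => nzp plu; rewrite [X in line_of _ X](point_vecE v).
by rewrite line_of_incidence // !plucker_vec_coord.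
Qed.

Lemma line_of_eq p (S : set 'cV[C]_4) :
    p != 0 -> plucker_relation p = 0 ->
    (forall v : 'cV[C]_4,
      [/\ p 0 0 * v 2 0 - p 0 1 * v 1 0 + p 0 3 * v 0 0 = 0,
          p 0 0 * v 3 0 - p 0 2 * v 1 0 + p 0 4 * v 0 0 = 0,
          p 0 1 * v 3 0 - p 0 2 * v 2 0 + p 0 5 * v 0 0 = 0 &
          p 0 3 * v 3 0 - p 0 4 * v 2 0 + p 0 5 * v 1 0 = 0] <-> S v) ->
  line_of p = S.
Proof.
by move=> nzp plu eqS; apply/seteqP; split=> v; rewrite line_of_coords // eqS.
Qed.

Lemma support_bit (b : bool) (x : C) :
  (x != 0) = b -> if b then is_true (x != 0) else x = 0.
Proof. by case: b => // /negbFE/eqP. Qed.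

Lemma coord_formE (i : 'I_4) (v : 'cV[C]_4) :
  coord_form C i *m v = 0 <-> v i 0 = 0.
Proof.
rewrite /coord_form -rowE; split=> [/rowP/(_ 0)|vi0]; first by rewrite !mxE.
by apply/rowP => j; rewrite !mxE ord1.
Qed.

Lemma linear_formE (k1 k2 k3 : C) (i1 i2 i3 : 'I_4) (v : 'cV[C]_4) :
  (k1 *: coord_form C i1 + k2 *: coord_form C i2 + k3 *: coord_form C i3) *m v
    = 0 <->
  k1 * v i1 0 + k2 * v i2 0 + k3 * v i3 0 = 0.
Proof.
rewrite !mulmxDl -!scalemxAl /coord_form -!rowE.
split=> [/rowP/(_ 0)|eq0]; first by rewrite !mxE.
by apply/rowP => j; rewrite !mxE ord1.
Qed.

Lemma form_line_coordsE (i j : 'I_4) :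
  form_line (coord_form C i) (coord_form C j) =
  [set v | v i 0 = 0 /\ v j 0 = 0].
Proof. by apply/seteqP; split=> v [/coord_formE vi /coord_formE vj]; split. Qed.

Lemma coord_line_fiber k t p : total_genericity t != 0 ->
  fiber (component_ideal (CoordLine k)) t p ->
  line_of p = octanomial_coord_line k.
Proof.
move=> gen_t fib_p; have [nzp _] := fib_p.
have [plu _] := fiber_I_ufv_lies_on (fiber_component_I_ufv fib_p).
have := fiber_support gen_t fib_p; rewrite /support_of.
case: k {gen_t fib_p} => [[|[|[|[|//]]]] ltk];
  rewrite /component_support /octanomial_coord_line (tnth_nth set0) /=;
  rewrite form_line_coordsE;
  move=> -[/support_bit/= e0 /support_bit/= e1 /support_bit/= e2
    /support_bit/= e3 /support_bit/= e4 /support_bit/= e5];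
  apply: line_of_eq => // v /=; rewrite ?e0 ?e1 ?e2 ?e3 ?e4 ?e5;
  (split; last by case=> -> ->; rewrite !(mul0r, mulr0, subr0, addr0)).
- case=> _ E1 _ E3; split; apply: (mulf0_r e4).
    by apply: (eq_comb1 (k1 := 1) E1); ring.
  by apply: (eq_comb1 (k1 := -1) E3); ring.
- case=> E0 _ _ E3; split; apply: (mulf0_r e3).
    by apply: (eq_comb1 (k1 := 1) E0); ring.
  by apply: (eq_comb1 (k1 := 1) E3); ring.
- case=> _ E1 E2 _; split; apply: (mulf0_r e2).
    by apply: (eq_comb1 (k1 := -1) E1); ring.
  by apply: (eq_comb1 (k1 := -1) E2); ring.
- case=> E0 _ E2 _; split; apply: (mulf0_r e1).
    by apply: (eq_comb1 (k1 := -1) E0); ring.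
  by apply: (eq_comb1 (k1 := 1) E2); ring.
Qed.

(** Three of the four incidence relations say that the coordinate vanishes,
    and by the equations of the family the last one is proportional to the
    second linear form of the line. *)
Lemma plane_line_fiber k t p : total_genericity t != 0 ->
  fiber (component_ideal (PlaneLine k)) t p -> line_of p = plane_line t k.
Proof.
move=> gen_t fib_p; have [nzp _] := fib_p.
have [plu _] := fiber_I_ufv_lies_on (fiber_component_I_ufv fib_p).
have := fiber_equations fib_p.
have := fiber_support gen_t fib_p; rewrite /support_of.
have := genericity_unact (component_sym (PlaneLine k)) gen_t.
have plane_eqP (k1 k2 k3 q12 q13 q23 y z w : C) :
    k1 != 0 -> q23 != 0 -> k1 * q13 + k2 * q23 = 0 -> k3 * q23 - k1 * q12 = 0 ->
    q12 * w - q13 * z + q23 * y = 0 <-> k1 * y + k2 * z + k3 * w = 0.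
  move=> nzk nzq eq1 eq2; split=> eq3.
    apply: (mulf0_r nzq).
    by apply: (eq_comb3 (k1 := k1) (k2 := w) (k3 := z) eq3 eq2 eq1); ring.
  apply: (mulf0_r nzk).
  by apply: (eq_comb3 (k1 := q23) (k2 := - w) (k3 := - z) eq3 eq2 eq1); ring.
have plane_lineE (i i1 i2 i3 : 'I_4) (k1 k2 k3 : C) :
    form_line (coord_form C i) (k1 *: coord_form C i1 + k2 *: coord_form C i2
                                + k3 *: coord_form C i3) =
    [set v | v i 0 = 0 /\ k1 * v i1 0 + k2 * v i2 0 + k3 * v i3 0 = 0].
  by apply/seteqP; split=> v [/coord_formE vi /linear_formE vj]; split.
rewrite (coef_vecE t).
move: (t 0 0) (t 0 1) (t 0 2) (t 0 3) (t 0 4) (t 0 5) (t 0 6) (t 0 7).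
move=> a b c d e f g h {gen_t fib_p}.
case: k => [[|[|[|[|//]]]] ltk]; rewrite /component_support /plane_line;
  rewrite !coef_vec_coord (tnth_nth set0) /= plane_lineE;
  rewrite /swap_xy_t /swap_zw_t /swap_pairs_t ?coef_vec_coord;
  move=> /generic_factors[[_ _ _ nzd] _ _ _ _];
  move=> -[/support_bit/= e0 /support_bit/= e1 /support_bit/= e2
    /support_bit/= e3 /support_bit/= e4 /support_bit/= e5] eqs;
  have := (eqs 3%N, eqs 4%N);
  rewrite /family_equations ?swap_xy_pE /swap_xy_p /swap_zw_p /swap_pairs_p;
  rewrite ?plucker_vec_coord !coef_vec_coord /= => -[E3 E4];
  apply: line_of_eq => // v /=; rewrite ?e0 ?e1 ?e2 ?e3 ?e4 ?e5.
- have [to_plane of_plane] :=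
    plane_eqP _ _ _ _ _ _ (v 1 0) (v 2 0) (v 3 0) nzd e5 E3 E4.
  split=> [[_ _ Ex L]|[vx F]].
    have v00 : v 0 0 = 0.
      by apply: (mulf0_r e5); apply: (eq_comb1 (k1 := 1) Ex); ring.
    split=> //; have {}L : p 0 3 * v 3 0 - p 0 4 * v 2 0 + p 0 5 * v 1 0 = 0.
      by apply: (eq_comb1 (k1 := 1) L); ring.
    by apply: (eq_comb1 (k1 := 1) (to_plane L)); ring.
  have {}F : d * v 1 0 + g * v 2 0 + h * v 3 0 = 0.
    by apply: (eq_comb1 (k1 := 1) F); ring.
  have {F}L := of_plane F; rewrite vx; split; try by ring.
  by apply: (eq_comb1 (k1 := 1) L); ring.
- have [to_plane of_plane] :=
    plane_eqP _ _ _ _ _ _ (v 0 0) (v 2 0) (v 3 0) nzd e5 E3 E4.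
  split=> [[_ _ L Ex]|[vx F]].
    have v10 : v 1 0 = 0.
      by apply: (mulf0_r e5); apply: (eq_comb1 (k1 := 1) Ex); ring.
    split=> //; have {}L : p 0 1 * v 3 0 - p 0 2 * v 2 0 + p 0 5 * v 0 0 = 0.
      by apply: (eq_comb1 (k1 := 1) L); ring.
    by apply: (eq_comb1 (k1 := 1) (to_plane L)); ring.
  have {}F : c * v 0 0 + g * v 2 0 + h * v 3 0 = 0.
    by apply: (eq_comb1 (k1 := 1) F); ring.
  have {F}L := of_plane F; rewrite vx; split; try by ring.
  by apply: (eq_comb1 (k1 := 1) L); ring.
- have [to_plane of_plane] :=
    plane_eqP _ _ _ _ _ _ (v 3 0) (v 0 0) (v 1 0) nzd e0 E3 E4.
  split=> [[Ex L _ _]|[vx F]].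
    have v20 : v 2 0 = 0.
      by apply: (mulf0_r e0); apply: (eq_comb1 (k1 := 1) Ex); ring.
    split=> //.
    have {}L : - p 0 2 * v 1 0 - - p 0 4 * v 0 0 + p 0 0 * v 3 0 = 0.
      by apply: (eq_comb1 (k1 := 1) L); ring.
    by apply: (eq_comb1 (k1 := 1) (to_plane L)); ring.
  have {}F : b * v 3 0 + e * v 0 0 + f * v 1 0 = 0.
    by apply: (eq_comb1 (k1 := 1) F); ring.
  have {F}L := of_plane F; rewrite vx; split; try by ring.
  by apply: (eq_comb1 (k1 := 1) L); ring.
- have [to_plane of_plane] :=
    plane_eqP _ _ _ _ _ _ (v 2 0) (v 0 0) (v 1 0) nzd e0 E3 E4.
  split=> [[L Ex _ _]|[vx F]].
    have v30 : v 3 0 = 0.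
      by apply: (mulf0_r e0); apply: (eq_comb1 (k1 := 1) Ex); ring.
    split=> //.
    have {}L : - p 0 1 * v 1 0 - - p 0 3 * v 0 0 + p 0 0 * v 2 0 = 0.
      by apply: (eq_comb1 (k1 := 1) L); ring.
    by apply: (eq_comb1 (k1 := 1) (to_plane L)); ring.
  have {}F : a * v 2 0 + e * v 0 0 + f * v 1 0 = 0.
    by apply: (eq_comb1 (k1 := 1) F); ring.
  have {F}L := of_plane F; rewrite vx; split; try by ring.
  by apply: (eq_comb1 (k1 := 1) L); ring.
Qed.

End Incidence.

(** * Degrees and incidence patterns *)

HB.instance Definition _ := gen_eqMixin component.

Definition components : seq component :=
  let i4 := [:: Ordinal (isT : 0 < 4); Ordinal (isT : 1 < 4);
                Ordinal (isT : 2 < 4); Ordinal (isT : 3 < 4)]%N in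
  let i2 := [:: Ordinal (isT : 0 < 2); Ordinal (isT : 1 < 2)]%N in
  map CoordLine i4 ++ map PlaneLine i4 ++ DisjointLine ::
  map TwoMeeting i2 ++ map OneMeeting i4.

Lemma components_uniq : uniq components.
Proof. by apply: (@map_uniq _ _ component_support). Qed.

Lemma mem_components k : k \in components.
Proof.
have i4P (i : 'I_4) : i \in [:: Ordinal (isT : 0 < 4); Ordinal (isT : 1 < 4);
    Ordinal (isT : 2 < 4); Ordinal (isT : 3 < 4)]%N.
  by case: i => [[|[|[|[|//]]]] lti]; rewrite !inE -!val_eqE.
have i2P (i : 'I_2) :
    i \in [:: Ordinal (isT : 0 < 2); Ordinal (isT : 1 < 2)]%N.
  by case: i => [[|[|//]] lti]; rewrite !inE -!val_eqE.
case: k => [i|i||i|i]; rewrite /components mem_cat.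
- by rewrite (map_f CoordLine (i4P i)).
- by rewrite mem_cat (map_f PlaneLine (i4P i)) orbT.
- by rewrite mem_cat mem_head !orbT.
- rewrite mem_cat [_ \in DisjointLine :: _]in_cons mem_cat.
  by rewrite (map_f TwoMeeting (i2P i)) !orbT.
- rewrite mem_cat [_ \in DisjointLine :: _]in_cons mem_cat.
  by rewrite (map_f OneMeeting (i4P i)) !orbT.
Qed.

Section Degrees.
Variable C : numClosedFieldType.
Implicit Types (t : 'rV[C]_8) (p : 'rV[C]_6).

(** Lines of different components have different supports. *)
Lemma fibers_flatten t (S : component -> seq 'rV[C]_6) (ks : seq component) :
    total_genericity t != 0 ->
    (forall k, pairwise (fun p q => ~~ (p == q)%MS) (S k)) ->
    (forall k, {in S k, forall p, fiber (component_ideal k) t p}) ->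
    uniq ks ->
  pairwise (fun p q => ~~ (p == q)%MS) (flatten (map S ks)).
Proof.
move=> gen_t pairS memS; elim: ks => //= k ks IHks /andP[k_ks /IHks pair_ks].
rewrite pairwise_cat pairS pair_ks !andbT.
apply/allrelP => p q /memS fib_p /flatten_mapP[l l_ks /memS fib_q].
apply: contraNN k_ks => pq; have [nzp _] := fib_p.
suff -> : k = l by [].
apply: component_support_inj.
rewrite -(fiber_support gen_t fib_p) -(fiber_support gen_t fib_q).
exact: support_same_line pq.
Qed.

Lemma I_ufv_generic_degree : generic_degree C I_ufv 27.
Proof.
apply: genericallyI => t gen_t.
have [S SP] := choice (fun k => component_fiber k gen_t).
exists (flatten (map S components)); split.
- rewrite size_flatten /shape -map_comp.
  have -> : map (size \o S) components = map component_degree components.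
    by apply: eq_map => k /=; case: (SP k).
  by [].
- apply: (fibers_flatten gen_t) => [k|k p pS|]; last exact: components_uniq.
    by case: (SP k).
  by case: (SP k) => _ _ memS _; case: (memS p pS).
- move=> p /flatten_mapP[k _ pS]; have [_ _ memS _] := SP k.
  by have [fib_p _] := memS p pS; exact: fiber_component_I_ufv fib_p.
move=> p /fiber_I_ufv_component[k fib_p]; have [_ _ _ all_S] := SP k.
have /hasP[q qS pq] := all_S p fib_p; apply/hasP; exists q => //.
by apply/flatten_mapP; exists k => //; exact: mem_components.
Qed.

Lemma component_generic_degree k :
  generic_degree C (component_ideal k) (component_degree k).
Proof.
apply: genericallyI => t gen_t.
have [S [sz_S pair_S mem_S all_S]] := component_fiber k gen_t.
by exists S; split=> // p /mem_S[].
Qed.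

Lemma disjoint_fiberP t p : total_genericity t != 0 ->
  fiber (component_ideal DisjointLine) t p -> (p == disjoint_line t)%MS.
Proof.
move=> gen_t fib_p; have [nzp _] := fib_p; apply/same_lineP => //.
have gen_t' := genericity_unact (component_sym DisjointLine) gen_t.
have eqs := fiber_equations fib_p.
rewrite /= (coef_vecE t) in gen_t' eqs *.
exact: (disjoint_equations gen_t' eqs).
Qed.

(** The only component whose support is full is that of the disjoint line. *)
Lemma disjoint_line_meets_none t p : total_genericity t != 0 ->
  fiber I_ufv t p ->
  ((forall S : {set 'I_4}, #|S| = 2%N ->
      ~ lines_meet (line_of p) (coordinate_line S)) <->
   (p == disjoint_line t)%MS).
Proof.
move=> gen_t fib_p; have [nzp _] := fib_p.
have [plu _] := fiber_I_ufv_lies_on fib_p; split=> [no_meet|p_disj S].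
  have [k fib_k] := fiber_I_ufv_component fib_p.
  suff k_disj : k = DisjointLine.
    by apply: disjoint_fiberP; rewrite -?k_disj.
  have nz j : p 0 j != 0.
    apply/eqP => pj0; apply: (no_meet _ (coordinate_pair_card j)).
    exact/lines_meet_coordinate.
  by apply: component_support_inj; rewrite -(fiber_support gen_t fib_k)
    /support_of !nz.
case/coordinate_pairP => j ->; rewrite lines_meet_coordinate // => pj0.
have gen_t' := genericity_unact (component_sym DisjointLine) gen_t.
rewrite /= (coef_vecE t) in gen_t'.
have := nth_support p j; rewrite pj0 eqxx (support_same_line nzp p_disj).
rewrite [X in disjoint_line X]coef_vecE (disjoint_line_support gen_t').
by case: j {pj0} => [[|[|[|[|[|[|//]]]]]] ltj].
Qed.

(** The pairs of indices of the coordinate lines that the lines of the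
    component meet. *)
Definition met_pairs k : {set {set 'I_4}} :=
  [set coordinate_pair j
     | j in [set j : 'I_6 | ~~ nth false (component_support k) j]%SET]%SET.

Lemma mem_met_pairs k (j : 'I_6) :
  (coordinate_pair j \in met_pairs k) = ~~ nth false (component_support k) j.
Proof. by rewrite mem_imset ?inE //; exact: coordinate_pair_inj. Qed.

Lemma fiber_meets_met_pairs k t p (S : {set 'I_4}) :
    total_genericity t != 0 -> fiber (component_ideal k) t p -> #|S| = 2%N ->
  lines_meet (line_of p) (coordinate_line S) <-> S \in met_pairs k.
Proof.
move=> gen_t fib_p /coordinate_pairP[j ->].
by rewrite mem_met_pairs; exact: fiber_meet fib_p.
Qed.

End Degrees.

Lemma two_meeting_pairs_inj : injective (fun k => met_pairs (TwoMeeting k)).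
Proof.
move=> k l eq_kl.
have eq_j (j : 'I_6) : ~~ nth false (component_support (TwoMeeting k)) j =
    ~~ nth false (component_support (TwoMeeting l)) j.
  by rewrite -!mem_met_pairs eq_kl.
have := eq_j (Ordinal (isT : 1 < 6)%N).
case: k l {eq_kl eq_j} => [[|[|//]] ltk] [[|[|//]] ltl] //= _; exact/val_inj.
Qed.

Lemma two_meeting_pairs_card k : #|met_pairs (TwoMeeting k)| = 2%N.
Proof.
rewrite card_imset; last exact: coordinate_pair_inj.
rewrite -sum1_card big_mkcond /= !big_ord_recl big_ord0 !inE /=.
by case: k => [[|[|//]] ltk].
Qed.

Definition one_meeting_pair (k : 'I_4) : {set 'I_4} :=
  coordinate_pair (inord k.+1).

Lemma one_meeting_pair_inj : injective one_meeting_pair.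
Proof.
move=> k l /coordinate_pair_inj /(congr1 val) /=.
have lt6 (i : 'I_4) : (i.+1 < 6)%N by rewrite ltnS ltnW // ltnS.
by rewrite !inordK // => -[] /val_inj.
Qed.

Lemma one_meeting_met_pairs k :
  met_pairs (OneMeeting k) = [set one_meeting_pair k]%SET.
Proof.
apply/finset.setP => S; rewrite finset.in_set1.
apply/imsetP/eqP => [[j + ->]|->]; last first.
  exists (inord k.+1) => //; rewrite inE.
  by case: k => [[|[|[|[|//]]]] ltk]; rewrite inordK.
rewrite inE /one_meeting_pair => jP; congr coordinate_pair.
apply/val_inj; rewrite /= inordK; last by rewrite ltnS ltnW // ltnS.
by case: k j jP => [[|[|[|[|//]]]] ltk] [[|[|[|[|[|[|//]]]]]] ltj].
Qed.

Theorem proposition2p8 (C : numClosedFieldType) :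
  generic_degree C I_ufv 27 /\
  exists M : component -> set ufv_ring,
    [/\ injective M,
        forall P, minimal_prime I_ufv P <-> exists k, P = M k,
        forall k, generic_degree C (M k) (component_degree k) &
    [/\ (* (i) *)
        generically (fun t : 'rV[C]_8 => forall k p,
          fiber (M (CoordLine k)) t p -> line_of p = octanomial_coord_line k),
        (* (ii) *)
        generically (fun t : 'rV[C]_8 => forall k p,
          fiber (M (PlaneLine k)) t p -> line_of p = plane_line t k),
        (* (iii) *)
        generically (fun t : 'rV[C]_8 =>
          (forall p, fiber (M DisjointLine) t p -> (p == disjoint_line t)%MS) /\
          (forall p, fiber I_ufv t p ->
             ((forall S : {set 'I_4}, #|S| = 2%N ->
                 ~ lines_meet (line_of p) (coordinate_line S)) <->
              (p == disjoint_line t)%MS))),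
        (* (iv) *)
        exists pairs : 'I_2 -> {set {set 'I_4}},
          [/\ injective pairs,
              forall k, #|pairs k| = 2%N,
              forall k S, S \in pairs k -> #|S| = 2%N &
              generically (fun t : 'rV[C]_8 => forall k p,
                fiber (M (TwoMeeting k)) t p ->
                forall S : {set 'I_4}, #|S| = 2%N ->
                  (lines_meet (line_of p) (coordinate_line S) <->
                   S \in pairs k))] &
        (* (v) *)
        exists L : 'I_4 -> {set 'I_4},
          [/\ injective L,
              forall k, #|L k| = 2%N &
              generically (fun t : 'rV[C]_8 => forall k p,
                fiber (M (OneMeeting k)) t p ->
                forall S : {set 'I_4}, #|S| = 2%N ->
                  (lines_meet (line_of p) (coordinate_line S) <->
                   S = L k))]]].
Proof.
split; first exact: I_ufv_generic_degree.
exists component_ideal; split.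
- by move=> k l eq_kl; apply: (component_ideal_sub C); rewrite eq_kl.
- exact: minimal_prime_component C.
- exact: component_generic_degree.
split.
- by apply: genericallyI => t gen_t k p; exact: coord_line_fiber.
- by apply: genericallyI => t gen_t k p; exact: plane_line_fiber.
- apply: genericallyI => t gen_t.
  by split=> p; [exact: disjoint_fiberP | exact: disjoint_line_meets_none].
- exists (fun k => met_pairs (TwoMeeting k)); split.
  + exact: two_meeting_pairs_inj.
  + exact: two_meeting_pairs_card.
  + by move=> k S /imsetP[j _ ->]; exact: coordinate_pair_card.
  apply: genericallyI => t gen_t k p fib_p S S2.
  exact: fiber_meets_met_pairs fib_p S2.
exists one_meeting_pair; split.
- exact: one_meeting_pair_inj.
- by move=> k; exact: coordinate_pair_card.
apply: genericallyI => t gen_t k p fib_p S S2.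
rewrite (fiber_meets_met_pairs gen_t fib_p S2) one_meeting_met_pairs.
rewrite finset.in_set1; symmetry; exact: (rwP eqP).
Qed.
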